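(* Let $\mathcal{E}$ be an exponential family of dimension $n$ defined over a finite set $\Omega=\{x_1,\dots,x_m\}$, and let $\Phi:\mathbb{T}^n\times N\to N$ be a Kähler toric manifold with Kähler metric $g$ which is a regular torification of $\mathcal{E}$. Suppose that the estimator map $F:\Omega\to\mathbb{R}^n$ is injective. Let $f$ be a Kähler function on $N$ such that $$f(p)=\mathbb{E}_{K(\phi(p))}(X)=\mathbb{E}_{K'(\phi'(p))}(X')\qquad\text{for all }p\in N,$$ where $\phi,\phi'\in\mathrm{Aut}(N,g)^0$, $X,X'\in\mathcal{A}_{\mathcal{E}}$, and where $K$ and $K'$ are the natural extensions of some compatible projections. Then the images of $X$ and $X'$ (as subsets of $\mathbb{R}$) coincide.
   Context: Kähler toric manifolds. $\mathbb{T}^n=\mathbb{R}^n/\mathbb{Z}^n$; its Lie algebra is identified with $\mathbb{R}^n$ via the derivative at $0$ of the quotient map, and $\mathbb{R}^n$ with its dual via the Euclidean product $\langle\,,\,\rangle$. For an action $\Phi:\mathbb{T}^n\times N\to N$ write $\Phi_a(p)=\Phi(a,p)$ and $\xi_N(p)=\frac{d}{dt}\big|_0\Phi([t\xi],p)$ for $\xi\in\mathbb{R}^n$. A Kähler toric manifold is a connected compact Kähler manifold $N$ of complex dimension $n$ (metric $g$, complex structure $I$, Kähler form $\omega=g(I\cdot,\cdot)$) with an effective action $\Phi$ of $\mathbb{T}^n$ by holomorphic isometries and a momentum map $\mathbf{J}:N\to\mathbb{R}^n$, i.e. a smooth $\mathbb{T}^n$-invariant map with $\omega(\xi_N,\cdot)=d\mathbf{J}^\xi$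 for all $\xi$, where $\mathbf{J}^\xi(p)=\langle\mathbf{J}(p),\xi\rangle$. $N^\circ$ is the (open, dense, connected) set of points where $\Phi$ is free. Exponential family. $\Omega$ carries the counting measure. $\mathcal{E}$ is the set of probability functions $p_\theta(x)=\exp\big(C(x)+\sum_{k=1}^n\theta_kF_k(x)-\psi(\theta)\big)$, $\theta\in\mathbb{R}^n$, where $C,F_1,\dots,F_n:\Omega\to\mathbb{R}$, $\psi:\mathbb{R}^n\to\mathbb{R}$, and $1,F_1,\dots,F_n$ are linearly independent; $\theta$ is a global chart of $\mathcal{E}$. $\mathbb{E}_p(X)=\sum_{x\in\Omega}X(x)p(x)$. $\mathcal{E}$ carries the Fisher metric $(h_F)_{ij}(\theta)=\mathbb{E}_{p_\theta}(\partial_i\ln p_\theta\,\partial_j\ln p_\theta)$ and the exponential connection $\nabla^{(e)}$, the flat connection for which $\theta_1,\dots,\theta_n$ are affine coordinates. The estimator map is $F=(F_1,\dots,F_n):\Omega\to\mathbb{R}^n$, and $\mathcal{A}_{\mathcal{E}}$ is the real vector space of functions on $\Omega$ spanned by $F_1,\dots,F_n,1$. Torification. With coordinates $(\theta,\dot\theta)$ on $T\mathcal{E}$ (for the tangent vector $\sum_k\dot\theta_k\partial/\partial\theta_k$ at $p_\theta$), $T\mathcal{E}$ is a Kähler manifold with holomorphic coordinates $z_k=\theta_k+i\dot\theta_k$ and metric given by the block-diagonal matrix $\mathrm{diag}(h_F(\theta),h_F(\theta))$. A parallel lattice $L\subset T\mathcal{E}$ is the set of all integer combinations $\sum k_iY_i(p)$,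 $p\in\mathcal{E}$, of a frame $Y=(Y_1,\dots,Y_n)$ of $\nabla^{(e)}$-parallel vector fields on $\mathcal{E}$ (a generator of $L$). $\Gamma(L)\cong\mathbb{Z}^n$ is the group of maps $u\mapsto u+\sum k_iY_i$ of $T\mathcal{E}$; $\mathcal{E}_L=T\mathcal{E}/\Gamma(L)$ with its induced Kähler structure, $q_L:T\mathcal{E}\to\mathcal{E}_L$ is the quotient map, $\pi_L:\mathcal{E}_L\to\mathcal{E}$ the induced projection, and $\mathbb{T}^n$ acts on $\mathcal{E}_L$ by $\Phi_Y([t],q_L(u))=q_L(u+\sum t_iY_i)$. $(N,\Phi)$ is a torification of $\mathcal{E}$ if there are a parallel lattice $L$, a generator $Y$ and a holomorphic isometric diffeomorphism $G:\mathcal{E}_L\to N^\circ$ with $G\circ(\Phi_Y)_a=\Phi_a\circ G$ for all $a\in\mathbb{T}^n$. It is regular if $N$ is connected, simply connected, complete and has real-analytic Kähler metric. A compatible projection is a map $\kappa=\pi_L\circ G^{-1}:N^\circ\to\mathcal{E}$ for some such triple $(L,Y,G)$. Natural extension. $\mathcal{P}_m$ is the set of all probability functions on $\Omega$, with the topology of pointwise convergence, and $\overline{\mathcal{E}}$ is the closure of $\mathcal{E}$ in $\mathcal{P}_m$. Each compatible projection $\kappa$ has a unique continuous extension $K:N\to\overline{\mathcal{E}}$, called its natural extension. Kähler functions. A smooth $f:N\to\mathbb{R}$ is Kähler if its Hamiltonian vector field $X_f$ (defined by $\omega(X_f,\cdot)=df$) is Killing, i.e. $\mathscr{L}_{X_f}g=0$.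 $\mathrm{Aut}(N,g)$ is the group of holomorphic isometries of $N$ with the compact-open topology (a compact Lie group), $\mathrm{Aut}(N,g)^0$ its identity component. *)

(* Defs.v *)
From HB Require Import structures.
From mathcomp Require Import all_boot all_order all_algebra.
From mathcomp Require Import generic_quotient ring_quotient archimedean.
From mathcomp Require Import all_classical all_reals all_analysis.

Set Implicit Arguments.
Unset Strict Implicit.
Unset Printing Implicit Defensive.

Import Order.TTheory GRing.Theory Num.Theory.
Import numFieldNormedType.Exports.

Local Open Scope classical_set_scope.
Local Open Scope ring_scope.
Local Open Scope quotient_scope.

Section calculus.
Context {R : realType}.

Fixpoint Ck (k : nat) {V W : normedModType R} (U : set V) (f : V -> W) : Prop :=
  {in U, continuous f} /\
  if k is k'.+1 then
    forall v, (forall x, U x -> derivable f x v) /\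
              Ck k' U (fun x => 'D_v f x)
  else True.

Definition Csmooth {V W : normedModType R} (U : set V) (f : V -> W) :=
  forall k, Ck k U f.

Definition dot {n} (u v : 'rV[R]_n) : R := \sum_i u ord0 i * v ord0 i.

Definition unitv {n} (i : 'I_n) : 'rV[R]_n := delta_mx ord0 i.

(* The model space: (x, y) stands for the point x + iy of C^n. *)
Definition Cspace (n : nat) : normedModType R := ('rV[R]_n * 'rV[R]_n)%type.

Definition mulI {n} (u : Cspace n) : Cspace n := (- u.2, u.1).

Definition monomial {n} (a b : 'I_n -> nat) (h : Cspace n) : R :=
  (\prod_i h.1 ord0 i ^+ a i) * (\prod_i h.2 ord0 i ^+ b i).

Definition box_sum {n} (c : ('I_n -> nat) -> ('I_n -> nat) -> R)
    (term : ('I_n -> nat) -> ('I_n -> nat) -> R) (N : nat) : R :=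
  \sum_(a : {ffun 'I_n -> 'I_N}) \sum_(b : {ffun 'I_n -> 'I_N})
    c (fun i => a i : nat) (fun i => b i : nat) *
    term (fun i => a i : nat) (fun i => b i : nat).

(* Local absolutely convergent power series expansions; the box partial sums
   exhaust the multi-indices. *)
Definition real_analytic {n} (U : set (Cspace n)) (f : Cspace n -> R) :=
  forall x, U x ->
  exists (c : ('I_n -> nat) -> ('I_n -> nat) -> R) (e : R), 0 < e /\
  forall h : Cspace n, `|h| < e ->
    cvgn (box_sum (fun a b => `|c a b|) (fun a b => `|monomial a b h|)) /\
    box_sum c (fun a b => monomial a b h) @ \oo --> f (x + h).

End calculus.
Arguments Cspace R n : clear implicits.

(* A chart: only the values of [fwd] on [dom] and of [bwd] on [cod] matter. *)
Record chart (R : realType) (n : nat) (M : Type) := Chart {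
  dom : set M;
  fwd : M -> Cspace R n;
  bwd : Cspace R n -> M }.

Definition cod {R : realType} {n M} (c : chart R n M) : set (Cspace R n) :=
  fwd c @` dom c.

(* Raw data of a manifold with a metric: an atlas and, for each chart, the
   coordinate expression x, u, v |-> g_x(u, v) of the metric; the axioms are
   those of [kahler_manifold]. The tangent space at a point is identified with
   the model space through a chart. *)
Record kahler_data (R : realType) (n : nat) (M : Type) := KahlerData {
  atlas : set (chart R n M);
  metric : chart R n M -> Cspace R n -> Cspace R n -> Cspace R n -> R }.

Section manifolds.
Context {R : realType} {n : nat}.
Implicit Types M N : topologicalType.

Definition is_chart {M} (c : chart R n M) :=
  [/\ open (dom c), open (cod c), {in dom c, cancel (fwd c) (bwd c)},
      {within dom c, continuous (fwd c)} & {within cod c, continuous (bwd c)}].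

Definition omega {M} (S : kahler_data R n M) (c : chart R n M)
  (x u v : Cspace R n) : R := metric S c x (mulI u) v.

Definition local_rep {M N} (f : M -> N) (c : chart R n M) (c' : chart R n N) :
  Cspace R n -> Cspace R n := fun x => fwd c' (f (bwd c x)).

(* Part of the codomain of c where [local_rep f c c'] represents f
   restricted to A *)
Definition local_dom {M N} (A : set M) (f : M -> N)
    (c : chart R n M) (c' : chart R n N) : set (Cspace R n) :=
  fwd c @` (dom c `&` A `&` f @^-1` dom c').

Definition smooth_on {M N} (S : kahler_data R n M) (T : kahler_data R n N)
    (A : set M) (f : M -> N) :=
  {in A, continuous f} /\
  forall c c', atlas S c -> atlas T c' ->
    Csmooth (local_dom A f c c') (local_rep f c c').

(* The Cauchy-Riemann equations: the differential commutes with the complex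
   structures *)
Definition holomorphic_on {M N} (S : kahler_data R n M) (T : kahler_data R n N)
    (A : set M) (f : M -> N) :=
  smooth_on S T A f /\
  forall c c', atlas S c -> atlas T c' ->
  forall x, local_dom A f c c' x -> forall v,
    'D_(mulI v) (local_rep f c c') x = mulI ('D_v (local_rep f c c') x).

Definition isometric_on {M N} (S : kahler_data R n M) (T : kahler_data R n N)
    (A : set M) (f : M -> N) :=
  forall c c', atlas S c -> atlas T c' ->
  forall x, local_dom A f c c' x -> forall u v,
    metric S c x u v =
    metric T c' (local_rep f c c' x)
      ('D_u (local_rep f c c') x) ('D_v (local_rep f c c') x).

Definition diffeo_onto {M N} (S : kahler_data R n M) (T : kahler_data R n N)
    (f : M -> N) (B : set N) :=
  [/\ smooth_on S T setT f, range f = B &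
      exists g : N -> M, cancel f g /\ smooth_on T S B g].

Definition smooth_fun {M} (S : kahler_data R n M) {W : normedModType R}
    (f : M -> W) :=
  forall c, atlas S c -> Csmooth (cod c) (fun x => f (bwd c x)).

Record kahler_manifold {M} (S : kahler_data R n M) : Prop := {
  km_hausdorff : hausdorff_space M;
  km_countable : @second_countable M;
  km_chart : forall c, atlas S c -> is_chart c;
  km_cover : forall p : M, exists2 c, atlas S c & dom c p;
  (* holomorphic transition maps, preserving the metric *)
  km_holo : holomorphic_on S S setT id;
  km_isom : isometric_on S S setT id;
  km_smooth : forall c u v, atlas S c ->
    Csmooth (cod c) (fun x => metric S c x u v);
  km_linear : forall c x, atlas S c -> cod c x -> forall a u u' v,
    metric S c x (a *: u + u') v = a * metric S c x u v + metric S c x u' v;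
  km_sym : forall c x, atlas S c -> cod c x -> forall u v,
    metric S c x u v = metric S c x v u;
  km_pos : forall c x, atlas S c -> cod c x -> forall u, u != 0 ->
    0 < metric S c x u u;
  km_hermitian : forall c x, atlas S c -> cod c x -> forall u v,
    metric S c x (mulI u) (mulI v) = metric S c x u v;
  (* d omega = 0, evaluated on constant vector fields *)
  km_closed : forall c x, atlas S c -> cod c x -> forall u v w,
    'D_u (fun y => omega S c y v w) x + 'D_v (fun y => omega S c y w u) x
    + 'D_w (fun y => omega S c y u v) x = 0 }.

(* A vector field is given by its coordinate expression in each chart. *)
Definition hamiltonian_field {M} (S : kahler_data R n M) (f : M -> R)
    (X : chart R n M -> Cspace R n -> Cspace R n) :=
  forall c x, atlas S c -> cod c x -> forall v,
    omega S c x (X c x) v = 'D_v (fun y => f (bwd c y)) x.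

(* (L_X g)(u, v) = X(g(u, v)) - g([X, u], v) - g(u, [X, v]), evaluated on
   constant vector fields u and v, for which [X, u] = - D_u X *)
Definition killing {M} (S : kahler_data R n M)
    (X : chart R n M -> Cspace R n -> Cspace R n) :=
  forall c x, atlas S c -> cod c x -> forall u v,
    'D_(X c x) (fun y => metric S c y u v) x
    + metric S c x ('D_u (X c) x) v + metric S c x u ('D_v (X c) x) = 0.

Definition kahler_function {M} (S : kahler_data R n M) (f : M -> R) :=
  smooth_fun S f /\ exists2 X, hamiltonian_field S f X & killing S X.

Definition Aut {M} (S : kahler_data R n M) : set {compact-open, M -> M} :=
  [set phi | [/\ diffeo_onto S S phi setT, holomorphic_on S S setT phi &
                 isometric_on S S setT phi]].

Definition Aut0 {M} (S : kahler_data R n M) : set {compact-open, M -> M} :=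
  connected_component (Aut S) idfun.

Definition simply_connected (M : topologicalType) :=
  forall gamma : R -> M,
    {within `[0, 1], continuous gamma} -> gamma 0 = gamma 1 ->
  exists H : R * R -> M,
    [/\ {within `[0, 1] `*` `[0, 1], continuous H},
        forall t, t \in `[0, 1] -> H (0, t) = gamma t,
        forall t, t \in `[0, 1] -> H (1, t) = gamma 0 &
        forall s, s \in `[0, 1] -> H (s, 0) = gamma 0 /\ H (s, 1) = gamma 0].

(* The geodesic equation is paired with an arbitrary vector w; the Christoffel
   symbols of the first kind, contracted with v, v, w, give
   (D_v g)(v, w) - (D_w g)(v, v) / 2. *)
Definition geodesic {M} (S : kahler_data R n M) (gamma : R -> M) :=
  continuous gamma /\
  forall c, atlas S c ->
    let x := fun t => fwd c (gamma t) in
    Csmooth (gamma @^-1` dom c : set R^o) (x : R^o -> Cspace R n) /\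
    forall t, dom c (gamma t) -> forall w,
      let v := derive1 x t in
      metric S c (x t) (derive1 (derive1 x) t) w
      + 'D_v (fun y => metric S c y v w) (x t)
      - 'D_w (fun y => metric S c y v v) (x t) / 2 = 0.

Definition complete_metric {M} (S : kahler_data R n M) :=
  forall c p v, atlas S c -> dom c p ->
  exists gamma : R -> M,
    [/\ geodesic S gamma, gamma 0 = p & derive1 (fun t => fwd c (gamma t)) 0 = v].

Definition analytic_metric {M} (S : kahler_data R n M) :=
  forall c u v, atlas S c -> real_analytic (cod c) (fun x => metric S c x u v).

Definition regular {M} (S : kahler_data R n M) :=
  [/\ connected [set: M], simply_connected M, complete_metric S &
      analytic_metric S].

End manifolds.

Definition int_vec {R : realType} {n} : pred 'rV[R]_n :=
  fun v => [forall i, v ord0 i \is a Num.int].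

Lemma int_vec_closed {R : realType} {n} : zmod_closed (@int_vec R n).
Proof.
split; first by apply/forallP => i; rewrite mxE rpred0.
by move=> u v /forallP uZ /forallP vZ; apply/forallP => i; rewrite !mxE rpredB.
Qed.

HB.instance Definition _ (R : realType) (n : nat) :=
  GRing.isZmodClosed.Build 'rV[R]_n (@int_vec R n) int_vec_closed.

Definition int_lattice (R : realType) (n : nat) : zmodClosed 'rV[R]_n :=
  GRing.ZmodClosed.clone _ (@int_vec R n) _.

Definition torus (R : realType) (n : nat) : zmodType :=
  Quotient.quot (int_lattice R n).

Definition torus_pi {R : realType} {n} (t : 'rV[R]_n) : torus R n :=
  \pi_(Quotient.quot (int_lattice R n)) t.

Section toric.
Context {R : realType} {n : nat} {M : topologicalType}.
Variables (S : kahler_data R n M) (Phi : torus R n -> M -> M).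

Definition is_action :=
  (forall p, Phi 0 p = p) /\
  (forall a b p, Phi (a + b) p = Phi a (Phi b p)).

(* Smoothness of T^n x N -> N, tested on R^n x N since R^n -> T^n is a
   covering *)
Definition smooth_action :=
  continuous (fun tp : 'rV[R]_n * M => Phi (torus_pi tp.1) tp.2) /\
  forall c c', atlas S c -> atlas S c' ->
    Csmooth [set tx : 'rV[R]_n * Cspace R n |
               cod c tx.2 /\ dom c' (Phi (torus_pi tx.1) (bwd c tx.2))]
            (fun tx : 'rV[R]_n * Cspace R n =>
               fwd c' (Phi (torus_pi tx.1) (bwd c tx.2))).

Definition fundamental_field (xi : 'rV[R]_n) (c : chart R n M) (p : M) :
  Cspace R n := derive1 (fun t : R => fwd c (Phi (torus_pi (t *: xi)) p)) 0.

Definition momentum_map (J : M -> 'rV[R]_n) :=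
  [/\ smooth_fun S J, forall a p, J (Phi a p) = J p &
      forall xi c p, atlas S c -> dom c p -> forall v,
        omega S c (fwd c p) (fundamental_field xi c p) v =
        'D_v (fun x => dot (J (bwd c x)) xi) (fwd c p)].

Record kahler_toric : Prop := {
  kt_kahler : kahler_manifold S;
  kt_connected : connected [set: M];
  kt_compact : compact [set: M];
  kt_action : is_action;
  kt_smooth : smooth_action;
  kt_aut : forall a, Aut S (Phi a);
  kt_effective : forall a, (forall p, Phi a p = p) -> a = 0;
  kt_momentum : exists J, momentum_map J }.

Definition free_points : set M := [set p | forall a, Phi a p = p -> a = 0].

End toric.

Section expfam.
Context {R : realType} {n : nat} {Omega : finType}.

Definition expect (p X : Omega -> R) : R := \sum_x X x * p x.

Definition prob_functions : set {ptws Omega -> R} :=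
  [set p | (forall x, 0 <= p x) /\ \sum_x p x = 1].

Definition exp_density (C : Omega -> R) (F : 'I_n -> Omega -> R)
    (psi : 'rV[R]_n -> R) (theta : 'rV[R]_n) (x : Omega) : R :=
  expR (C x + \sum_k theta ord0 k * F k x - psi theta).

End expfam.

Record exp_family (R : realType) (n : nat) (Omega : finType) := ExpFamily {
  efC : Omega -> R;
  efF : 'I_n -> Omega -> R;
  efpsi : 'rV[R]_n -> R;
  ef_prob : forall theta, \sum_x exp_density efC efF efpsi theta x = 1;
  ef_free : forall (a0 : R) (a : 'I_n -> R),
    (forall x, a0 + \sum_k a k * efF k x = 0) -> a0 = 0 /\ forall k, a k = 0 }.

Section torification.
Context {R : realType} {n : nat} {Omega : finType}.
Variable E : exp_family R n Omega.

Definition efp : 'rV[R]_n -> Omega -> R :=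
  exp_density (efC E) (efF E) (efpsi E).

Definition ef_set : set {ptws Omega -> R} := range efp.

Definition ef_closure : set {ptws Omega -> R} :=
  closure ef_set `&` prob_functions.

Definition estimator (x : Omega) : 'rV[R]_n := \row_k efF E k x.

Definition A_space : set (Omega -> R) :=
  [set X | exists (a0 : R) (a : 'I_n -> R),
     forall x, X x = a0 + \sum_k a k * efF E k x].

Definition fisher (theta : 'rV[R]_n) : 'M[R]_n :=
  \matrix_(i, j) expect (efp theta) (fun x =>
    'D_(unitv i) (fun t => ln (efp t x)) theta *
    'D_(unitv j) (fun t => ln (efp t x)) theta).

(* The tangent bundle of the family, in the coordinates (theta, theta-dot);
   since z = theta + i theta-dot, these are also the coordinates of its
   Kähler structure. *)
Definition TE := Cspace R n.

Definition TE_metric (u v w : TE) : R :=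
  (v.1 *m fisher u.1 *m w.1^T) ord0 ord0 +
  (v.2 *m fisher u.1 *m w.2^T) ord0 ord0.

(* A vector field on the family is given by its components in the affine
   coordinates theta of the exponential connection, so that its covariant
   derivative is the componentwise directional derivative. *)
Definition parallel (Y : 'rV[R]_n -> 'rV[R]_n) :=
  Csmooth setT Y /\ forall theta v, 'D_v Y theta = 0.

Definition parallel_frame (Y : 'I_n -> 'rV[R]_n -> 'rV[R]_n) :=
  (forall i, parallel (Y i)) /\
  (forall theta, \matrix_(i < n) Y i theta \in unitmx).

Definition translate (Y : 'I_n -> 'rV[R]_n -> 'rV[R]_n) (t : 'rV[R]_n)
  (u : TE) : TE := (u.1, u.2 + \sum_i t ord0 i *: Y i u.1).

(* u and v are in the same orbit of Gamma(L), L the lattice generated by Y. *)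
Definition lattice_equiv (Y : 'I_n -> 'rV[R]_n -> 'rV[R]_n) : rel TE :=
  fun u v => `[< exists2 k : 'rV[R]_n, k \in int_vec &
                 v = translate Y k u >].

Lemma translateD Y s t u : translate Y (s + t) u = translate Y s (translate Y t u).
Proof.
rewrite /translate /=; congr pair; rewrite -addrA -big_split /=; congr (_ + _).
by apply: eq_bigr => i _; rewrite mxE addrC scalerDl.
Qed.

Lemma translate0 Y u : translate Y 0 u = u.
Proof.
by rewrite /translate big1 ?addr0 -?surjective_pairing // => i _; rewrite mxE scale0r.
Qed.

Lemma lattice_equiv_class Y : equiv_class_of (lattice_equiv Y).
Proof.
have sym u v : lattice_equiv Y u v -> lattice_equiv Y v u.
  move=> /asboolP[k kZ ->]; apply/asboolP; exists (- k); first by rewrite rpredN.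
  by rewrite -translateD addNr translate0.
split=> [u|u v|v u w].
- by apply/asboolP; exists 0; rewrite ?rpred0 // translate0.
- by apply/idP/idP; exact: sym.
- move=> /asboolP[k kZ ->] /asboolP[l lZ ->]; apply/asboolP.
  by exists (l + k); rewrite ?rpredD // translateD.
Qed.

Canonical lattice_equiv_equiv Y := EquivRelPack (lattice_equiv_class Y).
Canonical lattice_equiv_encModRel Y := defaultEncModRel (lattice_equiv Y).

(* E_L = TE / Gamma(L), with the quotient topology *)
Definition EL (Y : 'I_n -> 'rV[R]_n -> 'rV[R]_n) : topologicalType :=
  quotient_topology {eq_quot (lattice_equiv Y)}.

Definition qL Y (u : TE) : EL Y := \pi_({eq_quot (lattice_equiv Y)}) u.

Definition EL_repr Y (z : EL Y) : TE :=
  repr (z : {eq_quot (lattice_equiv Y)}).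

(* The Kähler structure on E_L induced by that of TE: the charts are the
   continuous local sections of q_L, so that q_L is a local holomorphic
   isometry. *)
Definition EL_kahler Y : kahler_data R n (EL Y) :=
  KahlerData [set c : chart R n (EL Y) | is_chart c /\ bwd c = qL Y]
             (fun _ => TE_metric).

Definition piL Y (z : EL Y) : Omega -> R := efp (EL_repr z).1.

Definition PhiY Y (a : torus R n) (z : EL Y) : EL Y :=
  qL Y (translate Y
    (repr (a : Quotient.quot (int_lattice R n)))
    (EL_repr z)).

Lemma EL_reprP Y u : exists2 k : 'rV[R]_n, k \in int_vec &
  EL_repr (qL Y u) = translate Y k u.
Proof.
have : lattice_equiv Y u (EL_repr (qL Y u)).
  by rewrite -eqmodE /EL_repr reprK.
by move=> /asboolP.
Qed.

Lemma piLE Y u : piL (qL Y u) = efp u.1.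
Proof. by rewrite /piL; have [k _ ->] := EL_reprP Y u. Qed.

Lemma PhiYE Y t u : PhiY (torus_pi t) (qL Y u) = qL Y (translate Y t u).
Proof.
rewrite /PhiY /torus_pi; have [k kZ ->] := EL_reprP Y u.
case: piP => s /eqP; rewrite -Quotient.idealrBE => tsZ.
suff eq_st u' v : lattice_equiv Y u' v -> qL Y u' = qL Y v.
  apply: eq_st; apply/asboolP.
  exists (t - s - k); first by rewrite rpredB.
  by rewrite -!translateD [t - s - k + s]addrAC !subrK.
by move=> uv; apply: (eqP (T := {eq_quot (lattice_equiv Y)})); rewrite eqmodE.
Qed.

Section compatible.
Context {N : topologicalType}.
Variables (S : kahler_data R n N) (Phi : torus R n -> N -> N).

Definition toric_parametrization (Y : 'I_n -> 'rV[R]_n -> 'rV[R]_n)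
    (G : EL Y -> N) :=
  [/\ parallel_frame Y, diffeo_onto (EL_kahler Y) S G (free_points Phi),
      holomorphic_on (EL_kahler Y) S setT G,
      isometric_on (EL_kahler Y) S setT G &
      forall a z, G (PhiY a z) = Phi a (G z)].

Definition is_torification :=
  exists (Y : 'I_n -> 'rV[R]_n -> 'rV[R]_n) (G : EL Y -> N),
    toric_parametrization G.

Definition regular_torification := is_torification /\ regular S.

(* kappa = pi_L o G^-1 on the set of free points, which is the image of G;
   the values of kappa elsewhere are irrelevant *)
Definition compatible_projection (kappa : N -> Omega -> R) :=
  exists (Y : 'I_n -> 'rV[R]_n -> 'rV[R]_n) (G : EL Y -> N),
    toric_parametrization G /\ forall z, kappa (G z) = piL z.

Definition natural_extension (kappa K : N -> Omega -> R) :=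
  [/\ continuous (K : N -> {ptws Omega -> R}), forall p, ef_closure (K p) &
      forall p, free_points Phi p -> K p = kappa p].

End compatible.
End torification.

(* Main.v *)
From HB Require Import structures.
Require Import Defs.
From mathcomp Require Import all_boot all_order all_algebra.
From mathcomp Require Import generic_quotient ring_quotient.
From mathcomp Require Import all_classical all_reals all_analysis.
From mathcomp Require Import ring lra zify.

Set Implicit Arguments.
Unset Strict Implicit.
Unset Printing Implicit Defensive.

Import Order.TTheory GRing.Theory Num.Theory.
Import numFieldNormedType.Exports.

Local Open Scope classical_set_scope.
Local Open Scope ring_scope.

(**
On the tangent bundle of the family, in the coordinates (theta, theta-dot), the
function u |-> E_{p_theta}(X) with X = a0 + sum_k a_k F_k has the constant
gradient (a, 0).  Along a gradient line it equals Z'/Z, where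
Z(s) = sum_x c_x exp(s X(x)) with all c_x > 0, so that f, known along one of its
gradient lines through a free point, determines Z up to a factor, hence the set
of exponents of Z, which is the image of X.

Let p be a point such that phi(p) and phi'(p) are both free.  Near p the two
descriptions of f are related by the transition map
H = G'^-1 o phi' o phi^-1 o G, a local isometry of the two tangent bundles, which
therefore maps (a, 0) to (a', 0) and gradient lines to gradient lines.

Such a p exists because the free points are open and dense.  For density: a
nontrivial closed subgroup of the torus contains a nonzero torsion element, so
that, by Baire, if the free points missed an open set then some nonzero torsion
element would fix an open set pointwise; by the identity theorem for holomorphic
maps it would act trivially.  The identity theorem comes from the maximum
principle applied to |h|^2 exp(k/|z|^2) as k tends to infinity.
*)

(** * Directional derivatives and differentiability *)

Section line_calculus.
Context {R : realType}.

(** Smoothness is given through iterated directional derivatives, while isometries are composed by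
    the chain rule, which requires Fréchet differentiability; the passage from one to the other is
    made in coordinates. The reduction to torsion elements exists for the sake of countability. A
    stabilizer may a priori be generated by an element of infinite order, and the fixed sets of all
    nonzero torus elements form an uncountable family, out of reach of Baire's theorem; the torsion
    elements are countably many. The maximum principle is used because it only involves first and
    second derivatives at one extremum: the Cauchy-Riemann equations for maps of class C^2,
    restricted to a complex line, are all that enters. The weight exp(k/|z|^2) serves two ends: it
    is large near the zero set of h, so that an interior point beats the outer circle, and the
    Laplacian of its exponent is strictly positive, so that an interior maximum is impossible. *)

Lemma is_derive_line (V W : normedModType R) (f : V -> W) (x v : V) (t : R) :
  derivable f (x + t *: v) v ->
  is_derive t 1 (fun h : R => f (x + h *: v)) ('D_v f (x + t *: v)).
Proof.
have E : (fun h : R => h^-1 *: (((fun h : R => f (x + h *: v)) \o shift t) (h *: 1)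
    - f (x + t *: v))) =
  (fun h : R => h^-1 *: ((f \o shift (x + t *: v)) (h *: v) - f (x + t *: v))).
  apply/funext => h /=; congr (_ *: (f _ - _)).
  by rewrite (_ : h *: 1 = h) ?scalerDl 1?addrCA//; exact: mulr1.
move=> df; apply: DeriveDef.
  by rewrite /derivable E.
by rewrite /derive E.
Qed.

Lemma is_derive_dirZ (V : normedModType R) (f : V -> R) (x v : V) (c : R) :
  derivable f x v -> is_derive x (c *: v) f (c * 'D_v f x).
Proof.
move=> df.
have dl : is_derive (0 * c) 1 (fun t : R => f (x + t *: v)) ('D_v f x).
  have := @is_derive_line _ _ f x v (0 * c).
  by rewrite mul0r scale0r addr0; apply.
have dm : is_derive (0 : R) 1 (fun t : R => t * c) c.
  by apply: is_derive_eq; rewrite /GRing.scale/= mulr1 mulr0 add0r.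
have [dd1 dd2] := @is_derive1_comp _ (fun t : R => f (x + t *: v))
  (fun t : R => t * c) 0 _ _ dl dm.
have E : (fun k : R => k^-1 *: ((f \o shift x) (k *: (c *: v)) - f x)) =
  (fun k : R => k^-1 *: ((((fun t : R => f (x + t *: v)) \o (fun t : R => t * c))
     \o shift 0) (k *: 1)
     - ((fun t : R => f (x + t *: v)) \o (fun t : R => t * c)) 0)).
  apply/funext => k /=.
  rewrite addr0 mul0r scale0r addr0 (_ : k *: 1 = k); last exact: mulr1.
  by rewrite scalerA [x + _]addrC.
apply: DeriveDef; first by rewrite /derivable E.
by rewrite mulrC -dd2 /derive E.
Qed.

Lemma MVT_line (V : normedModType R) (f : V -> R) (x v : V) :
  (forall t : R, 0 <= t <= 1 -> derivable f (x + t *: v) v) ->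
  exists2 t : R, 0 <= t <= 1 & f (x + v) - f x = 'D_v f (x + t *: v).
Proof.
move=> df.
have dl (t : R) : 0 <= t <= 1 ->
    is_derive t 1 (fun h : R => f (x + h *: v)) ('D_v f (x + t *: v)).
  by move=> /df; exact: is_derive_line.
have [| |t t01] := @MVT_segment R (fun h => f (x + h *: v))
  (fun t => 'D_v f (x + t *: v)) 0 1 ler01.
- by move=> t; rewrite in_itv /= => /andP[t0 t1]; apply: dl; rewrite !ltW.
- apply: derivable_within_continuous => t; rewrite in_itv /= => t01.
  by have [] := dl t t01.
rewrite scale1r scale0r addr0 subr0 mulr1 => ->.
by exists t; first by rewrite in_itv in t01.
Qed.

Lemma derive0_cst (V : normedModType R) (f : V -> R) (x v : V) :
  (forall t : R, 0 <= t <= 1 -> is_derive (x + t *: v) v f 0) ->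
  f (x + v) = f x.
Proof.
move=> df; have [t t01|t t01 E] := @MVT_line V f x v.
  by have [] := df t t01.
by apply/eqP; rewrite -subr_eq0 E; have [_ ->] := df t t01.
Qed.

Lemma differentiable_eps (V W : normedModType R) (f : V -> W) (x : V)
    (L : {linear V -> W}) : continuous L ->
  (forall e : R, 0 < e ->
     \forall h \near (0 : V), `|f (h + x) - (f x + L h)| <= e * `|h|) ->
  differentiable f x.
Proof.
move=> cL fL.
have E : f \o shift x = cst (f x) + L +o_ 0 id.
  by apply/eqaddoP => e e0; exact: fL.
by apply/diff_locallyP; rewrite (diff_unique cL E).
Qed.

End line_calculus.

Section C1_differentiable.
Context {R : realType}.

(* A list of pairs (c, e) stands for the partial expansion h |-> sum c(h) e of
   h on vectors e with coordinate functions c. *)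
Lemma C1_partial_expansion (V : normedModType R) (f : V -> R) (x : V)
    (s : seq ((V -> R) * V)) :
  (forall v, (\forall y \near x, derivable f y v) /\
             {for x, continuous ('D_v f)}) ->
  all (fun p => `[< forall h, `|p.1 h| <= `|h| >]) s ->
  forall e : R, 0 < e -> \forall h \near (0 : V),
    `|f (x + \sum_(p <- s) p.1 h *: p.2)
      - (f x + \sum_(p <- s) p.1 h * 'D_(p.2) f x)| <= e * `|h|.
Proof.
move=> C1f; elim: s => [|[c v] s IH] /=.
  move=> _ e e0; near=> h.
  by rewrite !big_nil !addr0 subrr normr0 mulr_ge0// ltW.
move=> /andP[/asboolP cb sb] e e0.
have [K K0 Kb] : exists2 K : R, 0 < K & forall h (t : R), 0 <= t <= 1 ->
    `|\sum_(p <- s) p.1 h *: p.2 + t *: (c h *: v)| <= K * `|h|.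
  exists (\sum_(p <- s) `|p.2| + `|v| + 1).
    by rewrite ltr_wpDl// addr_ge0// sumr_ge0.
  move=> h t /andP[t0 t1]; rewrite (le_trans (ler_normD _ _))//.
  rewrite [leRHS]mulrDl mul1r mulrDl ler_wpDr// lerD//; last first.
    rewrite !normrZ mulrA mulrC ler_wpM2l// -[leRHS]mul1r.
    by rewrite ler_pM// ger0_norm.
  elim: s sb {IH} => [|[d w] s IHs] /=; first by rewrite !big_nil normr0 mul0r.
  move=> /andP[/asboolP db sb]; rewrite !big_cons /= (le_trans (ler_normD _ _))//.
  by rewrite mulrDl lerD ?IHs// normrZ mulrC ler_wpM2l.
have [df cdf] := C1f v.
have e20 : 0 < e / 2 by rewrite divr_gt0.
have : \forall y \near x, derivable f y v /\ `|'D_v f x - 'D_v f y| < e / 2.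
  near=> y; split; first by near: y.
  by near: y; move/cvgrPdist_lt : cdf; exact.
move=> /nbhs_ballP[d /= d0 dP].
near=> h.
rewrite !big_cons /= (addrCA x); set S := x + \sum_(p <- s) _.
have inb (t : R) : 0 <= t <= 1 -> ball x d (S + t *: (c h *: v)).
  move=> t01; rewrite -ball_normE /ball_ /= /S -addrA opprD addrA subrr sub0r normrN.
  rewrite (le_lt_trans (Kb h t t01))// mulrC -ltr_pdivlMr//.
  by near: h; apply: nbhs0_lt; rewrite divr_gt0.
have dcv y : derivable f y v -> is_derive y (c h *: v) f (c h * 'D_v f y).
  exact: is_derive_dirZ.
(* The new term [c h *: v] is added along a segment, on which the mean value theorem turns the
   increment of f into [c h] times a derivative at a point close to x. Since |c h| <= |h|, this
   costs at most (e / 2) |h|; the other half is left to the induction hypothesis. *)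
have [t t01 Et] := @MVT_line R V f S (c h *: v)
    (fun t t01 => @ex_derive _ _ _ _ _ _ _ (dcv _ (dP _ (inb t t01)).1)).
have [dy /ltW dye] := dP _ (inb t t01).
rewrite (@derive_val _ _ _ _ _ _ _ (dcv _ dy)) in Et.
rewrite [_ *: _ + S]addrC -(subrK (f S) (f (S + _))) Et.
have -> : c h * 'D_v f (S + t *: (c h *: v)) + f S -
   (f x + (c h * 'D_v f x + \sum_(p <- s) p.1 h * 'D_(p.2) f x)) =
   c h * ('D_v f (S + t *: (c h *: v)) - 'D_v f x) +
   (f S - (f x + \sum_(p <- s) p.1 h * 'D_(p.2) f x)) by ring.
rewrite (le_trans (ler_normD _ _))// [e in leRHS]splitr mulrDl lerD//.
  by rewrite normrM mulrC ler_pM// distrC.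
by rewrite /S; near: h; exact: IH.
Unshelve. all: by end_near. Qed.

End C1_differentiable.

Section linear_derive.
Context {R : realType}.

Lemma is_derive_linear (V W W' : normedModType R) (L : {linear W -> W'})
    (f : V -> W) (x v : V) :
  continuous L -> derivable f x v ->
  is_derive x v (fun y => L (f y)) (L ('D_v f x)).
Proof.
move=> cL df.
have E : (fun h : R => h^-1 *: (((fun y => L (f y)) \o shift x) (h *: v)
   - L (f x))) = L \o (fun h : R => h^-1 *: ((f \o shift x) (h *: v) - f x)).
  by apply/funext => h /=; rewrite linearZ_LR [in RHS]linearB.
have cvL : (L \o (fun h : R => h^-1 *: ((f \o shift x) (h *: v) - f x)))
    @ 0^' --> L ('D_v f x).
  apply: (@cvg_comp _ _ _ _ _ _ (nbhs ('D_v f x))); last exact: cL.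
  by move/cvg_ex: df => [l fl]; rewrite /derive (cvg_lim _ fl).
apply: DeriveDef; first by rewrite /derivable E; apply/cvg_ex; exists (L ('D_v f x)).
by rewrite /derive E; apply: cvg_lim.
Qed.

Lemma dist_half (a b c c' e : R) :
  c = c' -> `|a - c| < e / 2 -> `|b - c'| < e / 2 -> `|a - b| <= e.
Proof.
move=> -> /ltW ac /ltW bc; rewrite -(subrKA c' a (- b)).
by rewrite (le_trans (ler_normD _ _))// [e]splitr lerD// distrC.
Qed.

(** The mean value theorem is used twice: along v for the increment [g] of f in the direction w,
    then along w for ['D_v f]. *)
Lemma second_difference (V : normedModType R) (f : V -> R) (x v w : V) (d t : R) :
  (forall y, ball x d y -> derivable f y v /\ derivable ('D_v f) y w) ->
  `|t| * (`|v| + `|w|) < d ->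
  exists2 y, ball x d y &
    f (x + t *: v + t *: w) - f (x + t *: v) - f (x + t *: w) + f x =
    t * (t * 'D_w ('D_v f) y).
Proof.
move=> df td.
have inb (a b : R) : 0 <= a <= 1 -> 0 <= b <= 1 ->
    ball x d (x + a *: (t *: v) + b *: (t *: w)).
  move=> /andP[a0 a1] /andP[b0 b1]; rewrite -ball_normE /ball_ /=.
  rewrite -addrA opprD addrA subrr sub0r normrN (le_lt_trans _ td)//.
  rewrite (le_trans (ler_normD _ _))// mulrDr lerD//.
    by rewrite normrZ ger0_norm// normrZ ler_piMl// mulr_ge0.
  by rewrite normrZ ger0_norm// normrZ ler_piMl// mulr_ge0.
have i0 : (0 <= (0 : R) <= 1) by rewrite lexx ler01.
have i1 : (0 <= (1 : R) <= 1) by rewrite lexx ler01.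
pose g := fun y => f (y + t *: w) - f y.
have dg (a : R) : 0 <= a <= 1 ->
    is_derive (x + a *: (t *: v)) (t *: v) g
      (t * ('D_v f (x + a *: (t *: v) + t *: w) - 'D_v f (x + a *: (t *: v)))).
  move=> a01; rewrite mulrBr; apply: is_deriveB; last first.
    by apply: is_derive_dirZ; have := inb _ _ a01 i0; rewrite scale0r addr0 => /df[].
  have dd : is_derive (x + a *: (t *: v) + t *: w) (t *: v) f
      (t * 'D_v f (x + a *: (t *: v) + t *: w)).
    by apply: is_derive_dirZ; have := inb _ _ a01 i1; rewrite scale1r => /df[].
  have E : (fun h : R => h^-1 *: (((fun y => f (y + t *: w)) \o
       shift (x + a *: (t *: v))) (h *: (t *: v)) - f (x + a *: (t *: v) + t *: w))) =
     (fun h : R => h^-1 *: ((f \o shift (x + a *: (t *: v) + t *: w)) (h *: (t *: v))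
       - f (x + a *: (t *: v) + t *: w))).
    by apply/funext => h /=; rewrite -!addrA.
  case: dd => dd1 dd2; apply: DeriveDef; first by rewrite /derivable E.
  by rewrite -dd2 /derive E.
have [a a01|a a01 Ea] := @MVT_line R V g x (t *: v).
  by have [] := dg a a01.
have [_ Eg] := dg a a01; rewrite Eg {Eg} in Ea.
have dh (b : R) : 0 <= b <= 1 ->
    is_derive (x + a *: (t *: v) + b *: (t *: w)) (t *: w) ('D_v f)
      (t * 'D_w ('D_v f) (x + a *: (t *: v) + b *: (t *: w))).
  by move=> b01; apply: is_derive_dirZ; have /df[] := inb _ _ a01 b01.
have [b b01|b b01 Eb] := @MVT_line R V ('D_v f) (x + a *: (t *: v)) (t *: w).
  by have [] := dh b b01.
have [_ Eg] := dh b b01; rewrite Eg {Eg} in Eb.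
exists (x + a *: (t *: v) + b *: (t *: w)); first exact: inb.
by rewrite -Eb -Ea /g; ring.
Qed.

(** Schwarz's theorem. The second difference is symmetric in v and w, so the two mixed derivatives
    take a common value, each at its own point of an arbitrarily small ball; continuity carries both
    values to x. *)
Lemma mixed_derivatives (V : normedModType R) (f : V -> R) (x v w : V) :
  (\forall y \near x, [/\ derivable f y v, derivable f y w,
     derivable ('D_v f) y w & derivable ('D_w f) y v]) ->
  {for x, continuous ('D_w ('D_v f))} -> {for x, continuous ('D_v ('D_w f))} ->
  'D_w ('D_v f) x = 'D_v ('D_w f) x.
Proof.
move=> df cvw cwv; apply/eqP; rewrite -subr_eq0 -normr_le0.
apply/ler_addgt0Pr => e e0; rewrite add0r.
have e20 : 0 < e / 2 by rewrite divr_gt0.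
have : \forall y \near x, [/\ derivable f y v /\ derivable ('D_v f) y w,
    derivable f y w /\ derivable ('D_w f) y v,
    `|'D_w ('D_v f) x - 'D_w ('D_v f) y| < e / 2 &
    `|'D_v ('D_w f) x - 'D_v ('D_w f) y| < e / 2].
  move/cvgrPdist_lt : cvw => /(_ _ e20) cvw.
  move/cvgrPdist_lt : cwv => /(_ _ e20) cwv.
  apply: filterS3 df cvw cwv => y [dv dw dvw dwv] A B.
  exact: And4 (conj dv dvw) (conj dw dwv) A B.
move=> /nbhs_ballP[d /= d0 dP].
have [t t0 td] : exists2 t : R, 0 < t & `|t| * (`|v| + `|w|) < d.
  exists (d / (`|v| + `|w| + 1)).
    by rewrite divr_gt0// ltr_wpDl// addr_ge0.
  have vw : 0 < `|v| + `|w| + 1 by rewrite ltr_wpDl// addr_ge0.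
  rewrite gtr0_norm ?divr_gt0// -mulrA gtr_pMr// mulrC ltr_pdivrMr// mul1r.
  by rewrite ltrDl.
have [y yx Ey] := @second_difference V f x v w d t
  (fun y yd => let: And4 A _ _ _ := dP y yd in A) td.
rewrite (addrC `|v|) in td.
have [z zx Ez] := @second_difference V f x w v d t
  (fun y yd => let: And4 _ A _ _ := dP y yd in A) td.
have E : 'D_w ('D_v f) y = 'D_v ('D_w f) z.
  apply: (mulfI (lt0r_neq0 t0)); apply: (mulfI (lt0r_neq0 t0)).
  apply: etrans (esym Ey) _; apply: etrans _ Ez.
  rewrite [x + t *: w + _]addrAC; congr (_ + _); exact: addrAC.
have [_ _ dy _] := dP _ yx; have [_ _ _ dz] := dP _ zx.
exact: dist_half E dy dz.
Qed.

End linear_derive.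

Section Ck_lemmas.
Context {R : realType}.

Lemma Ck_eq (V W : normedModType R) k (U : set V) (f g : V -> W) :
  open U -> (forall x, U x -> f x = g x) -> Ck k U f -> Ck k U g.
Proof.
move=> oU; elim: k f g => [|k IH] f g fg /= [cf df].
all: have nfg x : U x -> \forall y \near x, f y = g y.
1,3: by move=> Ux; apply: filterS fg _; exact: open_nbhs_nbhs.
all: have cg : {in U, continuous g}.
1,3: move=> x Ux; rewrite /prop_for /continuous_at -(fg x (set_mem Ux)).
1,2: by apply: cvg_trans (cf x Ux); apply: near_eq_cvg; exact/nfg/set_mem.
  by split.
split=> // v; have [dv Cv] := df v; split.
  by move=> x Ux; apply: near_eq_derivable (dv x Ux); exact: nfg.
apply: IH Cv => x Ux; exact/near_eq_derive/nfg.
Qed.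

Lemma Ck_linear (V W W' : normedModType R) k (U : set V) (f : V -> W)
    (L : {linear W -> W'}) :
  open U -> continuous L -> Ck k U f -> Ck k U (fun x => L (f x)).
Proof.
move=> oU cL; elim: k f => [|k IH] f /= [cf df].
all: have cg : {in U, continuous (fun x => L (f x))}.
1,3: by move=> x Ux; apply: continuous_comp; [exact: cf|exact: cL].
  by split.
split=> // v; have [dv Cv] := df v; split.
  by move=> x Ux; have [] := is_derive_linear cL (dv x Ux).
apply: Ck_eq (IH _ Cv) => // x Ux.
by have [_ ->] := is_derive_linear cL (dv x Ux).
Qed.

End Ck_lemmas.

Section Cspace_coordinates.
Context {R : realType} {n : nat}.
Implicit Types x : Cspace R n.

(** The Boolean selects the half of x + iy: [false] for x, [true] for y. One statement then covers
    both kinds of real coordinates. *)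
Definition crd (b : bool) (i : 'I_n) (x : Cspace R n) : R :=
  (if b then x.2 else x.1) ord0 i.

Definition crd_basis (b : bool) (i : 'I_n) : Cspace R n :=
  if b then (0, unitv i) else (unitv i, 0).

Lemma crd_linear b i : linear (crd b i).
Proof. by case: b => c u v; rewrite /crd /= !mxE. Qed.

HB.instance Definition _ b i :=
  GRing.isLinear.Build R (Cspace R n) R _ (crd b i) (crd_linear b i).

Lemma le_mx_norm (u : 'rV[R]_n) i : `|u ord0 i| <= `|u|.
Proof. by rewrite [leRHS]mx_normrE; exact: (le_bigmax _ _ (ord0, i)). Qed.

Lemma le_crd_norm b i x : `|crd b i x| <= `|x|.
Proof. by rewrite prod_normE le_max /crd; case: b; rewrite le_mx_norm ?orbT. Qed.

Lemma crd_continuous b i : continuous (crd b i).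
Proof.
apply/linear_bounded_continuous/linear_boundedP; near=> r => x.
by rewrite (le_trans (le_crd_norm b i x))// ler_peMl//; near: r; exact: nbhs_pinfty_ge.
Unshelve. all: by end_near. Qed.

Lemma Cspace_ext x y : (forall b i, crd b i x = crd b i y) -> x = y.
Proof.
case: x y => [x1 x2] [y1 y2] E; congr (_, _); apply/rowP => i.
  exact: (E false i).
exact: (E true i).
Qed.

Lemma crd_sum x :
  x = \sum_i crd false i x *: crd_basis false i
    + \sum_i crd true i x *: crd_basis true i.
Proof.
have crds b i c (a : 'I_n -> R) :
    crd b i (\sum_j a j *: crd_basis c j) = (b == c)%:R * a i.
  rewrite linear_sum /= (bigD1 i) //= big1 ?addr0.
    rewrite linearZ /= mulrC; congr (_ * _).
    by case: b c => -[]; rewrite /crd /= ?mxE ?eqxx.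
  move=> j ji; rewrite linearZ /= [X in _ *: X](_ : _ = 0) ?scaler0//.
  by case: b c => -[]; rewrite /crd /= ?mxE// eqxx eq_sym (negbTE ji).
apply: Cspace_ext => b i; rewrite linearD /=.
rewrite (crds b i false (crd false ^~ x)) (crds b i true (crd true ^~ x)).
by case: b; rewrite /= ?mul0r ?mul1r ?addr0 ?add0r.
Qed.

Lemma C1_differentiableR (U : set (Cspace R n)) (f : Cspace R n -> R) x :
  open U -> U x -> (forall v, (forall y, U y -> derivable f y v) /\
     {in U, continuous ('D_v f)}) -> differentiable f x.
Proof.
move=> oU Ux C1f.
pose s := [seq (crd false i, crd_basis false i) | i <- enum 'I_n] ++
          [seq (crd true i, crd_basis true i) | i <- enum 'I_n].
pose L (h : Cspace R n) : R := \sum_(p <- s) p.1 h * 'D_(p.2) f x.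
have L_linear : linear L.
  move=> c u v; rewrite /L scaler_sumr -big_split /=.
  rewrite /s !big_cat /= !big_map; congr (_ + _); apply: eq_bigr => i _ /=;
  by rewrite linearP /= mulrDl scalerAl.
pose LM := GRing.isLinear.Build R (Cspace R n) R _ L L_linear.
pose LL : {linear Cspace R n -> R} := HB.pack L LM.
have allb : all (fun p : (Cspace R n -> R) * Cspace R n =>
    `[< forall h, `|p.1 h| <= `|h| >]) s.
  by rewrite all_cat !all_map; apply/andP; split; apply/allP => i _ /=;
    apply/asboolP; exact: le_crd_norm.
apply: (@differentiable_eps R _ _ f x LL).
  apply/linear_bounded_continuous/linear_boundedP.
  near=> r => h /=; rewrite /L (le_trans (ler_norm_sum _ _ _))//.
  apply: (@le_trans _ _ ((\sum_(p <- s) `|'D_(p.2) f x|) * `|h|)); last first.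
    by rewrite ler_wpM2r//; near: r; apply: nbhs_pinfty_ge; rewrite num_real.
  rewrite mulr_suml big_seq [leRHS]big_seq ler_sum// => p ps.
  rewrite normrM mulrC ler_wpM2l//.
  by move/allP : allb => /(_ _ ps)/asboolP.
have C1x v : (\forall y \near x, derivable f y v) /\ {for x, continuous ('D_v f)}.
  have [dv cv] := C1f v; split; last by apply: cv; exact/mem_set.
  by apply: filterS dv _; exact: open_nbhs_nbhs.
have Es h : x + \sum_(p <- s) p.1 h *: p.2 = h + x.
  rewrite addrC; congr (_ + _).
  by rewrite [RHS]crd_sum /s big_cat /= !big_map.
move=> e e0.
apply: filterS (@C1_partial_expansion R _ f x s C1x allb e e0) => h.
by rewrite Es.
Unshelve. all: by end_near. Qed.

Lemma Ck1_differentiable (U : set (Cspace R n)) (f : Cspace R n -> Cspace R n) x :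
  open U -> U x -> Ck 1 U f -> differentiable f x.
Proof.
move=> oU Ux Cf.
have dc b i : differentiable (fun y => crd b i (f y)) x.
  apply: (C1_differentiableR oU Ux) => v.
  have [_ /(_ v)[dv [cv _]]] := Ck_linear oU (@crd_continuous b i) Cf.
  by split.
have -> : f = (fun y => \sum_i crd false i (f y) *: crd_basis false i
    + \sum_i crd true i (f y) *: crd_basis true i).
  by apply/funext => y; rewrite -crd_sum.
have ds b : differentiable (fun y => \sum_i crd b i (f y) *: crd_basis b i) x.
  rewrite [X in differentiable X _](_ : _ =
    \sum_i (fun y => crd b i (f y) *: crd_basis b i)).
    by apply: differentiable_sum => i; exact: differentiableZl.
  by apply/funext => y; rewrite fct_sumE.
exact: differentiableD.
Qed.

End Cspace_coordinates.

(** * Unique continuation for holomorphic maps *)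

Section unique_continuation.
Context {R : realType}.

(** [f1] vanishes at the maximum; if d were positive, [f1] would be positive just to the right of x
    and f would increase there. *)
Lemma second_derivative_test (f f1 : R -> R) (x d e : R) : 0 < e ->
  (forall y : R, `|y - x| < e -> is_derive y 1 f (f1 y)) -> is_derive x 1 f1 d ->
  (forall y : R, `|y - x| < e -> f y <= f x) -> d <= 0.
Proof.
move=> e0 df df1 fmax.
have inb y : y \in `]x - e, x + e[%R -> `|y - x| < e.
  by rewrite in_itv /= => ?; rewrite ltr_distl.
have f1x : f1 x = 0.
  have xe : x \in `]x - e, x + e[%R by rewrite in_itv /=; apply/andP; split; lra.
  have [||y /inb/fmax//|_ <-] := @derive1_at_max R f (x - e) (x + e) x _ _ xe.
  - lra.
  - by move=> y /inb/df[].
  by have [_ ->] := df x (inb x xe).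
rewrite leNgt; apply/negP => d0.
case: df1 => df1 d1E.
have : (fun h : R => h^-1 *: (f1 (h *: 1 + x) - f1 x)) @ 0^' --> d.
  by rewrite -d1E; exact: df1.
move=> /cvgrPdist_lt/(_ _ d0)[a /= a0 Ha].
pose b := Num.min a e.
have b0 : 0 < b by rewrite lt_min a0.
have f1pos y : x < y < x + b -> 0 < f1 y.
  move=> /andP[xy yb].
  have yx : `|0 - (y - x)| < a.
    rewrite sub0r normrN gtr0_norm ?subr_gt0//.
    by move: yb; rewrite /b -ltrBlDl lt_min => /andP[].
  have /= := Ha (y - x) yx; rewrite subr_eq0 (gt_eqF xy) => /(_ isT).
  rewrite f1x subr0 (_ : _ *: 1 = y - x); last exact: mulr1.
  rewrite subrK ltr_distlC => /andP[+ _].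
  by rewrite subrr pmulr_rgt0// invr_gt0 subr_gt0.
have be y : x <= y <= x + b / 2 -> `|y - x| < e.
  move=> /andP[xy yb]; rewrite ger0_norm ?subr_ge0//.
  have : b <= e by rewrite ge_min lexx orbT.
  lra.
have xb : x < x + b / 2 by lra.
have [||c] := @MVT R f f1 x (x + b / 2) xb.
- by move=> y; rewrite in_itv /= => /andP[? ?]; apply/df/be/andP; split; lra.
- apply: derivable_within_continuous => y; rewrite in_itv /= => /be/df[]//.
rewrite in_itv /= => /andP[xc cb] E.
have : f (x + b / 2) <= f x by apply/fmax/be; lra.
have : 0 < f1 c * (x + b / 2 - x).
  by rewrite mulr_gt0// ?f1pos; lra.
lra.
Qed.

(* The left-hand side is the second derivative at x of (p^2 + q^2) exp w,
   divided by exp w. *)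
Lemma weighted_max_test (p q w p1 q1 w1 : R -> R) (x p2 q2 w2 e : R) : 0 < e ->
  (forall y : R, `|y - x| < e -> [/\ is_derive y 1 p (p1 y),
     is_derive y 1 q (q1 y) & is_derive y 1 w (w1 y)]) ->
  is_derive x 1 p1 p2 -> is_derive x 1 q1 q2 -> is_derive x 1 w1 w2 ->
  (forall y : R, `|y - x| < e ->
     (p y ^+ 2 + q y ^+ 2) * expR (w y) <= (p x ^+ 2 + q x ^+ 2) * expR (w x)) ->
  2 * (p1 x ^+ 2 + p x * p2 + q1 x ^+ 2 + q x * q2)
  + 4 * (p x * p1 x + q x * q1 x) * w1 x
  + (p x ^+ 2 + q x ^+ 2) * (w1 x ^+ 2 + w2) <= 0.
Proof.
move=> e0 d1 dp2 dq2 dw2 vmax.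
pose g := fun y => 2 * (p y * p1 y + q y * q1 y) + (p y ^+ 2 + q y ^+ 2) * w1 y.
have dg (y : R) : `|y - x| < e ->
    is_derive y 1 (fun y => (p y ^+ 2 + q y ^+ 2) * expR (w y)) (g y * expR (w y)).
  move=> /d1[dp dq dw].
  have de : is_derive y 1 (fun y => expR (w y)) (w1 y * expR (w y)).
    rewrite mulrC; exact: (@is_derive1_comp _ expR w).
  apply: is_derive_eq.
  rewrite /g /GRing.scale /= /GRing.scale /=. ring.
have [dp dq dw] : [/\ is_derive x 1 p (p1 x),
     is_derive x 1 q (q1 x) & is_derive x 1 w (w1 x)].
  by apply: d1; rewrite subrr normr0.
have de : is_derive x 1 (fun y => expR (w y)) (w1 x * expR (w x)).
  rewrite mulrC; exact: (@is_derive1_comp _ expR w).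
set D := (X in X <= 0).
have dge : is_derive x 1 (fun y => g y * expR (w y)) (D * expR (w x)).
  rewrite /g; apply: is_derive_eq; rewrite /GRing.scale /= /GRing.scale /= /D; ring.
have := second_derivative_test e0 dg dge vmax.
by rewrite pmulr_lle0// expR_gt0.
Qed.

Lemma cvg_sqr (T : Type) (F : set_system T) (FF : Filter F) (f : T -> R) (l : R) :
  f @ F --> l -> (fun x => f x ^+ 2) @ F --> l ^+ 2.
Proof.
move=> fl; rewrite expr2 (_ : (fun x => f x ^+ 2) = f \* f); first exact: cvgM.
by apply/funext => x; rewrite expr2.
Qed.

(** Here h = P + iQ is holomorphic on the disc of radius 2, the t-derivatives being expressed by the
    Cauchy-Riemann equations. Where h is nonzero, log |h|^2 is harmonic and 1/r^2 strictly
    subharmonic, so |h|^2 exp(k/r^2) has no positive interior maximum. If h were nonzero at (1, 0),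
    its maximum on the annulus del <= r^2 <= 4 would avoid the inner circle, where h = 0, and, for a
    suitable k, the outer one, because (1, 0) lies strictly inside. *)
Lemma CR_vanish (P Q Ps Qs Pss Qss : R -> R -> R) (del : R) : 0 < del ->
  (forall s t : R, s ^+ 2 + t ^+ 2 <= 4 ->
   [/\ is_derive s 1 (P ^~ t) (Ps s t), is_derive s 1 (Q ^~ t) (Qs s t),
       is_derive t 1 (P s) (- Qs s t) & is_derive t 1 (Q s) (Ps s t)] /\
   [/\ is_derive s 1 (Ps ^~ t) (Pss s t), is_derive s 1 (Qs ^~ t) (Qss s t),
       is_derive t 1 (Ps s) (- Qss s t) & is_derive t 1 (Qs s) (Pss s t)]) ->
  (forall z : R * R, z.1 ^+ 2 + z.2 ^+ 2 <= 4 ->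
     {for z, continuous (fun z : R * R => P z.1 z.2)} /\
     {for z, continuous (fun z : R * R => Q z.1 z.2)}) ->
  (forall s t, s ^+ 2 + t ^+ 2 <= del -> P s t = 0 /\ Q s t = 0) ->
  P 1 0 = 0 /\ Q 1 0 = 0.
Proof.
move=> del0 dPQ cPQ PQ0.
have [del1|del1] := lerP 1 del.
  by apply: PQ0; rewrite expr1n expr0n addr0.
pose u s t := P s t ^+ 2 + Q s t ^+ 2.
have u_ge0 s t : 0 <= u s t by rewrite addr_ge0// sqr_ge0.
suff : u 1 0 <= 0.
  move=> u0; have := sqr_ge0 (P 1 0); have := sqr_ge0 (Q 1 0) => q0 p0.
  by split; apply/eqP; rewrite -sqrf_eq0; apply/eqP; move: u0; rewrite /u; lra.
rewrite leNgt; apply/negP => u10.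
pose r2 (z : R * R) := z.1 ^+ 2 + z.2 ^+ 2.
have cr2 : continuous r2.
  by move=> z; apply: cvgD; apply: cvg_sqr; [exact: cvg_fst|exact: cvg_snd].
pose A := [set z : R * R | del <= r2 z <= 4].
have cA : compact A.
  apply: (@subclosed_compact _ A (`[(-2 : R), 2]%classic `*` `[(-2 : R), 2]%classic)).
  - have -> : A = r2 @^-1` (`[del, 4]%classic) by apply/seteqP; split=> z; rewrite /A /= in_itv.
    by apply: preimage_closed => //; exact: interval_closed.
  - by apply: compact_setX; exact: segment_compact.
  - move=> [s t] /andP[_]; rewrite /r2 /= !in_itv /= => st.
    have := sqr_ge0 s; have := sqr_ge0 t => t0 s0.
    by split; apply/andP; split; nra.
have A1 : A (1, 0) by rewrite /A /r2 /= expr1n expr0n addr0; apply/andP; split; lra.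
have cu z : A z -> {for z, continuous (fun z : R * R => u z.1 z.2)}.
  by move=> /andP[_ /cPQ[cP cQ]]; apply: cvgD; apply: cvg_sqr.
have within_cont (g : R * R -> R) : (forall z, A z -> {for z, continuous g}) ->
    {within A, continuous g}.
  by move=> cg; apply: continuous_in_subspaceT => z /set_mem/cg.
have [M _ Mmax] := compact_EVT_max (ex_intro _ _ A1) cA (within_cont _ cu).
set m := u M.1 M.2 in Mmax.
have m10 : u 1 0 <= m by apply: (Mmax (1, 0)); exact/mem_set.
(* Chosen so that exp(3k/4) = exp(m / u 1 0) exceeds m / u 1 0: on the outer circle r^2 = 4 the
   weighted function is at most m exp(k/4), hence less than its value u 1 0 exp(k) at (1, 0). *)
pose k := 4 / 3 * (m / u 1 0).
have k0 : 0 < k by rewrite !mulr_gt0// ?invr_gt0// (lt_le_trans u10).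
pose v (z : R * R) := u z.1 z.2 * expR (k / r2 z).
have cv z : A z -> {for z, continuous v}.
  move=> Az; apply: cvgM; first exact: cu.
  apply: continuous_comp; last exact: continuous_expR.
  apply: cvgM; first exact: cvg_cst.
  by apply: cvgV (cr2 _); move: Az => /andP[? _]; rewrite gt_eqF// (lt_le_trans del0).
have [[s t] /set_mem Az vmax] := compact_EVT_max (ex_intro _ _ A1) cA (within_cont _ cv).
have v1 : u 1 0 * expR k <= v (s, t).
  have := vmax (1, 0) (mem_set A1).
  by rewrite {1}/v /r2 /= expr1n expr0n addr0 divr1.
have v0 : 0 < v (s, t) by rewrite (lt_le_trans _ v1)// mulr_gt0// expR_gt0.
have ust : 0 < u s t by move: v0; rewrite /v /= pmulr_lgt0// expR_gt0.
have st_del : del < r2 (s, t).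
  rewrite ltNge; apply/negP => /PQ0[P0 Q0].
  by move: ust; rewrite /u P0 Q0 expr0n addr0 ltxx.
have st_4 : r2 (s, t) < 4.
  rewrite ltNge; apply/negP => st4.
  have E4 : r2 (s, t) = 4 by apply/eqP; rewrite eq_le st4 andbT; move: Az => /andP[].
  have : u 1 0 * expR k <= m * expR (k / 4).
    by rewrite (le_trans v1)// /v E4 ler_wpM2r ?expR_ge0// Mmax//; exact/mem_set.
  have -> : expR k = expR (m / u 1 0) * expR (k / 4).
    by rewrite -expRD; congr expR; rewrite /k; field; rewrite gt_eqF.
  rewrite mulrA ler_pM2r ?expR_gt0//.
  move=> ineq; have := expR_ge1Dx (m / u 1 0) => ge1.
  have : u 1 0 * (1 + m / u 1 0) <= m by rewrite (le_trans _ ineq)// ler_pM2l.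
  by rewrite mulrDr mulr1 mulrC divfK ?gt_eqF// gerDr leNgt u10.
have [e e0 He] : exists2 e : R, 0 < e & forall s' t', `|s' - s| < e -> `|t' - t| < e ->
    A (s', t').
  have : nbhs ((s, t) : R * R) A.
    apply: filterS (_ : nbhs _ (r2 @^-1` `]del, 4[%classic)).
      by move=> z; rewrite /A /= in_itv /= => /andP[? ?]; rewrite !ltW.
    apply: cr2; apply: open_nbhs_nbhs; split; first exact: interval_open.
    by rewrite /= in_itv /= st_del.
  move=> /nbhs_ballP[e /= e0 eA]; exists e => // s' t' ss tt; apply: eA.
  by split; rewrite -ball_normE /= distrC.
pose w s t := k / (s ^+ 2 + t ^+ 2).
pose ws s t := - (2 * k * s / (s ^+ 2 + t ^+ 2) ^+ 2).
have nz s' t' : A (s', t') -> s' ^+ 2 + t' ^+ 2 != 0.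
  by move=> /andP[+ _]; rewrite /r2 /= => d; rewrite gt_eqF// (lt_le_trans del0).
have dr (s' t' : R) : is_derive s' 1 (fun s' => s' ^+ 2 + t' ^+ 2) (2 * s').
  by apply: is_derive_eq; rewrite /GRing.scale /=; ring.
have dw (s' t' : R) : A (s', t') -> is_derive s' 1 (w ^~ t') (ws s' t').
  move=> /nz nz0; have dV := @is_deriveV R (fun s' => s' ^+ 2 + t' ^+ 2) s' _ 1 nz0 (dr s' t').
  apply: is_derive_eq; rewrite /ws /GRing.scale /=.
  by field.
pose wss s t := - (2 * k / (s ^+ 2 + t ^+ 2) ^+ 2)
   + 8 * k * s ^+ 2 / (s ^+ 2 + t ^+ 2) ^+ 3.
have dws (s' t' : R) : A (s', t') -> is_derive s' 1 (ws ^~ t') (wss s' t').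
  move=> /nz nz0.
  have nz2 : (s' ^+ 2 + t' ^+ 2) ^+ 2 != 0 by rewrite expf_neq0.
  have dr2 : is_derive s' 1 (fun s' => (s' ^+ 2 + t' ^+ 2) ^+ 2)
      (2 * (s' ^+ 2 + t' ^+ 2) * (2 * s')).
    by apply: is_derive_eq; rewrite /GRing.scale /= /GRing.scale /=; ring.
  have dV := @is_deriveV R (fun s' => (s' ^+ 2 + t' ^+ 2) ^+ 2) s' _ 1 nz2 dr2.
  apply: is_derive_eq; rewrite /wss /GRing.scale /=.
  by field.
have ss : `|s - s| < e by rewrite subrr normr0.
have tt : `|t - t| < e by rewrite subrr normr0.
have Ale s' t' : A (s', t') -> s' ^+ 2 + t' ^+ 2 <= 4 by move=> /andP[].
have AC s' t' : A (s', t') -> A (t', s') by rewrite /A /r2 /= addrC.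
have [[dPs dQs dPt dQt] [dPss dQss dPst dQst]] := dPQ s t (Ale _ _ Az).
have I1 := @weighted_max_test (P ^~ t) (Q ^~ t) (w ^~ t) (Ps ^~ t) (Qs ^~ t)
  (ws ^~ t) s (Pss s t) (Qss s t) (wss s t) e e0.
have I2 := @weighted_max_test (P s) (Q s) (w s) (fun t => - Qs s t) (Ps s)
  (fun t => ws t s) t (- Pss s t) (- Qss s t) (wss t s) e e0.
have {I1} : 2 * (Ps s t ^+ 2 + P s t * Pss s t + Qs s t ^+ 2 + Q s t * Qss s t)
    + 4 * (P s t * Ps s t + Q s t * Qs s t) * ws s t
    + u s t * (ws s t ^+ 2 + wss s t) <= 0.
  apply: (I1 _ dPss dQss (dws s t Az)).
  - move=> s' /He/(_ tt) As; have [[A1' A2' _ _] _] := dPQ s' t (Ale _ _ As).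
    exact: (And3 A1' A2' (dw s' t As)).
  - by move=> s' /He/(_ tt) As; exact/(vmax (s', t))/mem_set.
have {I2} : 2 * ((- Qs s t) ^+ 2 + P s t * (- Pss s t) + Ps s t ^+ 2
      + Q s t * (- Qss s t))
    + 4 * (P s t * (- Qs s t) + Q s t * Ps s t) * ws t s
    + u s t * (ws t s ^+ 2 + wss t s) <= 0.
  have wE : w s = w ^~ s by apply/funext => t'; rewrite /w addrC.
  apply: (I2 _ (is_deriveN dQst) dPst (dws t s (AC s t Az))).
  - move=> t' /(He s t' ss) At; have [[_ _ A1' A2'] _] := dPQ s t' (Ale _ _ At).
    rewrite wE; exact: (And3 A1' A2' (dw t' s (AC s t' At))).
  - by move=> t' /(He s t' ss) At; exact/(vmax (s, t'))/mem_set.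
(* The sum of the two pure second derivatives is the Laplacian of k/r^2, namely 4k/r^4. *)
have wpos : 0 < u s t * (wss s t + wss t s).
  rewrite mulr_gt0// (_ : wss s t + wss t s = 4 * k / (s ^+ 2 + t ^+ 2) ^+ 2).
    apply: divr_gt0; first by rewrite mulr_gt0.
    by rewrite exprn_gt0// (lt_trans del0).
  have nz0 := nz _ _ Az; rewrite /wss [t ^+ 2 + _]addrC; by field.
(* The sum of the two inequalities is |2h' + h (w_s - i w_t)|^2 + |h|^2 (w_ss + w_tt) <= 0, where h'
   = Ps + i Qs. The squares supplied here are those of the real and imaginary parts of 2h' + h (w_s
   - i w_t). *)
have := sqr_ge0 (2 * Ps s t + P s t * ws s t + Q s t * ws t s).
have := sqr_ge0 (2 * Qs s t + Q s t * ws s t - P s t * ws t s).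
move: wpos; rewrite /u; nra.
Qed.

End unique_continuation.

(** * Vanishing of holomorphic maps of several variables *)

Section holomorphic_vanish.
Context {R : realType} {n : nat}.
Implicit Types v : Cspace R n.

Lemma norm_mulI v : `|mulI v| = `|v|.
Proof. by rewrite !prod_normE /= normrN maxC. Qed.

(** The maximum norm is not invariant under rotations of the complex line; bounding the two terms
    separately costs the factor 2. *)
Lemma le_norm_mulI (q v : Cspace R n) (c s t : R) : 0 <= c ->
  s ^+ 2 + t ^+ 2 <= c ^+ 2 -> `|q - (q + s *: v + t *: mulI v)| <= 2 * c * `|v|.
Proof.
move=> c0 stc; rewrite -addrA opprD addrA subrr sub0r normrN.
rewrite (le_trans (ler_normD _ _))// !normrZ norm_mulI -mulrDl ler_wpM2r//.
have sq x y : x ^+ 2 + y ^+ 2 <= c ^+ 2 -> `|x| <= c.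
  move=> xy; rewrite -(@ler_pXn2r _ 2)// ?nnegrE// real_normK ?num_real//.
  by have := sqr_ge0 y; lra.
by have := sq s t stc; have := sq t s; rewrite addrC => /(_ stc); lra.
Qed.

(** Restriction to the complex line (s, t) |-> q + s v + t Iv reduces the claim to one variable, q +
    v being the image of (1, 0). The disc of radius 2 is mapped within distance 4|v| of q, whence
    the bound r / 4. *)
Lemma CR_component_vanish (a b : Cspace R n -> R) (q v : Cspace R n) (r : R) :
  Ck 2 (ball q r) a -> Ck 2 (ball q r) b ->
  (forall y w, ball q r y -> 'D_(mulI w) a y = - 'D_w b y /\
                            'D_(mulI w) b y = 'D_w a y) ->
  (\forall y \near q, a y = 0 /\ b y = 0) ->
  `|v| < r / 4 -> a (q + v) = 0 /\ b (q + v) = 0.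
Proof.
move=> Ca Cb CR ab0 vr.
have r0 : 0 < r by have := normr_ge0 v; lra.
have oB : open (ball q r) by exact: ball_open.
pose pt (s t : R) := q + s *: v + t *: mulI v.
have inb (s t : R) : s ^+ 2 + t ^+ 2 <= 4 -> ball q r (pt s t).
  move=> st; rewrite -ball_normE /ball_ /= /pt.
  rewrite (le_lt_trans (@le_norm_mulI q v 2 s t _ _))//; last lra.
  by rewrite (le_trans st)//; lra.
have ds (g : Cspace R n -> R) (s t : R) : derivable g (pt s t) v ->
    is_derive s 1 (fun s => g (pt s t)) ('D_v g (pt s t)).
  rewrite /pt [q + _ + _]addrAC => /is_derive_line.
  rewrite [X in is_derive _ _ X](_ : _ = (fun s => g (pt s t)))//.
  by apply/funext => s'; rewrite /pt addrAC.
have dt (g : Cspace R n -> R) (s t : R) : derivable g (pt s t) (mulI v) ->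
    is_derive t 1 (g \o pt s) ('D_(mulI v) g (pt s t)).
  by move=> /is_derive_line.
have D1 (g : Cspace R n -> R) w y : Ck 2 (ball q r) g -> ball q r y -> derivable g y w.
  by move=> [_ /(_ w)[+ _]]; apply.
have D2 (g : Cspace R n -> R) w w' y : Ck 2 (ball q r) g -> ball q r y ->
    derivable ('D_w g) y w'.
  by move=> [_ /(_ w)[_ [_ /(_ w')[+ _]]]]; apply.
have C2 (g : Cspace R n -> R) w w' y : Ck 2 (ball q r) g -> ball q r y ->
    {for y, continuous ('D_w' ('D_w g))}.
  by move=> [_ /(_ w)[_ [_ /(_ w')[_ [+ _]]]]] yr; apply; exact/mem_set.
have nb y : ball q r y -> nbhs y (ball q r) by move=> yr; exact: open_nbhs_nbhs.
have sw (g : Cspace R n -> R) y : Ck 2 (ball q r) g -> ball q r y ->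
    'D_(mulI v) ('D_v g) y = 'D_v ('D_(mulI v) g) y.
  move=> Cg yr; apply: mixed_derivatives; [|exact: C2|exact: C2].
  apply: filterS (nb _ yr) => z zr.
  exact: (And4 (D1 _ _ _ Cg zr) (D1 _ _ _ Cg zr) (D2 _ _ _ _ Cg zr) (D2 _ _ _ _ Cg zr)).
(* Symmetry of second derivatives transfers the Cauchy-Riemann equations from a and b to their
   derivatives along v. *)
have a12 y : ball q r y -> 'D_(mulI v) ('D_v a) y = - 'D_v ('D_v b) y.
  move=> yr; rewrite (sw a y Ca yr) (_ : - 'D_v _ y = 'D_v (fun y => - 'D_v b y) y).
    by apply: near_eq_derive; apply: filterS (nb _ yr) => z zr; have [] := CR z v zr.
  by rewrite (deriveN (D2 _ _ _ _ Cb yr)).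
have b12 y : ball q r y -> 'D_(mulI v) ('D_v b) y = 'D_v ('D_v a) y.
  move=> yr; apply: etrans (sw b y Cb yr) _.
  by apply: near_eq_derive; apply: filterS (nb _ yr) => z zr; have [] := CR z v zr.
have cpt (z : R * R) : (fun z : R * R => pt z.1 z.2) @ z --> pt z.1 z.2.
  rewrite /pt; apply: cvgD; first apply: cvgD; first exact: cvg_cst.
    by apply: cvgZr_tmp; exact: cvg_fst.
  by apply: cvgZr_tmp; exact: cvg_snd.
have [d /= d0 Hd] : exists2 d : R, 0 < d & forall y, ball q d y -> a y = 0 /\ b y = 0.
  by move/nbhs_ballP : ab0 => [d /= d0 Hd]; exists d.
(* The disc of radius c is mapped within 2 c |v| < d of q, where both functions vanish; the summand
   1 also covers v = 0. *)
pose c := d / (2 * (`|v| + 1)).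
have v1 : 0 < `|v| + 1 by rewrite ltr_wpDl.
have c0 : 0 < c by rewrite divr_gt0// mulr_gt0.
have := @CR_vanish R (fun s t => a (pt s t)) (fun s t => b (pt s t))
  (fun s t => 'D_v a (pt s t)) (fun s t => 'D_v b (pt s t))
  (fun s t => 'D_v ('D_v a) (pt s t)) (fun s t => 'D_v ('D_v b) (pt s t))
  (c ^+ 2) (exprn_gt0 _ c0).
rewrite /= (_ : pt 1 0 = q + v); last by rewrite /pt scale1r scale0r addr0.
apply.
- move=> s t /inb yr; have [CR1 CR2] := CR _ v yr; split; split.
  + exact: ds (D1 _ _ _ Ca yr).
  + exact: ds (D1 _ _ _ Cb yr).
  + rewrite -CR1; exact: dt (D1 _ _ _ Ca yr).
  + rewrite -CR2; exact: dt (D1 _ _ _ Cb yr).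
  + exact: ds (D2 _ _ _ _ Ca yr).
  + exact: ds (D2 _ _ _ _ Cb yr).
  + rewrite -(a12 _ yr); exact: dt (D2 _ _ _ _ Ca yr).
  + rewrite -(b12 _ yr); exact: dt (D2 _ _ _ _ Cb yr).
- move=> z /inb yr; split.
    apply: (@continuous_comp _ _ _ (fun z : R * R => pt z.1 z.2) a); first exact: cpt.
    by have [+ _] := Ca; apply; exact/mem_set.
  apply: (@continuous_comp _ _ _ (fun z : R * R => pt z.1 z.2) b); first exact: cpt.
  by have [+ _] := Cb; apply; exact/mem_set.
- move=> s t stc; apply: Hd; rewrite -ball_normE /ball_ /=.
  rewrite (le_lt_trans (le_norm_mulI q v (ltW c0) stc))// /c.
  rewrite [X in X * _](_ : _ = d / (`|v| + 1)); last by field; rewrite gt_eqF.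
  by rewrite mulrAC ltr_pdivrMr// ltr_pM2l// ltrDl.
Qed.

Lemma holomorphic_vanish (h : Cspace R n -> Cspace R n) (q v : Cspace R n) (r : R) :
  Ck 2 (ball q r) h ->
  (forall y w, ball q r y -> 'D_(mulI w) h y = mulI ('D_w h y)) ->
  (\forall y \near q, h y = 0) -> `|v| < r / 4 -> h (q + v) = 0.
Proof.
move=> Ch CR h0 vr.
have r0 : 0 < r by have := normr_ge0 v; lra.
have oB : open (ball q r) by exact: ball_open.
have Cc b i := Ck_linear oB (@crd_continuous R n b i) Ch.
have D b i y w : ball q r y -> 'D_w (fun y => crd b i (h y)) y = crd b i ('D_w h y).
  move=> yr.
  have dh : derivable h y w by have [_ /(_ w)[+ _]] := Ch; apply.
  by have [_ ->] := is_derive_linear (@crd_continuous R n b i) dh.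
suff H i : crd false i (h (q + v)) = 0 /\ crd true i (h (q + v)) = 0.
  by apply: Cspace_ext => b i; rewrite linear0; case: b; case: (H i).
apply: (@CR_component_vanish _ _ q v r (Cc false i) (Cc true i)) => //.
  move=> y w yr.
  rewrite (D false i y (mulI w) yr) (D true i y (mulI w) yr) (CR y w yr).
  rewrite (D false i y w yr) (D true i y w yr) /crd /=.
  by split; [exact: mxE|reflexivity].
by apply: filterS h0 => y ->; rewrite !linear0.
Qed.

End holomorphic_vanish.

(** * Charts and the identity theorem *)

Section Ck_more.
Context {R : realType} {V W : normedModType R}.
Implicit Types f g : V -> W.

Lemma Ck_sub k (U U' : set V) f : U' `<=` U -> Ck k U f -> Ck k U' f.
Proof.
move=> UU; elim: k f => [|k IH] f /= [cf df].
  by split=> // x /set_mem/UU/mem_set; exact: cf.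
split=> [x /set_mem/UU/mem_set|v]; first exact: cf.
have [dv Cv] := df v; split; last exact: IH.
by move=> x /UU; exact: dv.
Qed.

Lemma Ck_cst k (U : set V) (a : W) : Ck k U (cst a).
Proof.
elim: k a => [|k IH] a /=; first by split=> // x _; exact: cst_continuous.
split=> [x _|v]; first exact: cst_continuous.
split=> [x _|]; first exact: derivable_cst.
by under eq_fun do rewrite derive_cst; exact: IH.
Qed.

Lemma CkB k (U : set V) f g :
  open U -> Ck k U f -> Ck k U g -> Ck k U (fun x => f x - g x).
Proof.
move=> oU; elim: k f g => [|k IH] f g /= [cf df] [cg dg].
all: have cfg : {in U, continuous (fun x => f x - g x)}.
1,3: by move=> x Ux; apply: continuousB; [exact: cf|exact: cg].
  by split.
split=> // v; have [dfv Cfv] := df v; have [dgv Cgv] := dg v; split.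
  by move=> x Ux; apply: derivableB; [exact: dfv|exact: dgv].
apply: Ck_eq (IH _ _ Cfv Cgv) => // x Ux.
by rewrite (deriveB (dfv x Ux) (dgv x Ux)).
Qed.

End Ck_more.

Lemma Ck_id {R : realType} {V : normedModType R} k (U : set V) : Ck k U id.
Proof.
case: k => [|k] /=; first by split=> // x _; exact: cvg_id.
split=> [x _|v]; first exact: cvg_id.
split=> [x _|]; first exact: derivable_id.
by under eq_fun do rewrite derive_id; exact: Ck_cst.
Qed.

Section charts.
Context {R : realType} {n : nat}.
Implicit Types M N : topologicalType.

Section one_chart.
Context {M : topologicalType} (c : chart R n M) (cP : is_chart c).

Lemma bwd_dom x : cod c x -> dom c (bwd c x).
Proof. by have [_ _ cK _ _] := cP; move=> [p dp <-]; rewrite cK//; exact/mem_set. Qed.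

Lemma bwdK x : cod c x -> fwd c (bwd c x) = x.
Proof. by have [_ _ cK _ _] := cP; move=> [p dp <-]; rewrite cK//; exact/mem_set. Qed.

Lemma fwdK p : dom c p -> bwd c (fwd c p) = p.
Proof. by have [_ _ cK _ _] := cP; move=> dp; rewrite cK//; exact/mem_set. Qed.

Lemma fwd_cod p : dom c p -> cod c (fwd c p).
Proof. by move=> dp; exists p. Qed.

Lemma fwd_continuous_at p : dom c p -> {for p, continuous (fwd c)}.
Proof.
have [od _ _ + _] := cP; rewrite continuous_open_subspace// => cf dp.
by apply: cf; exact/mem_set.
Qed.

Lemma bwd_continuous_at x : cod c x -> {for x, continuous (bwd c)}.
Proof.
have [_ oc _ _ +] := cP; rewrite continuous_open_subspace// => cf dp.
by apply: cf; exact/mem_set.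
Qed.

Lemma nbhs_dom p : dom c p -> nbhs p (dom c).
Proof. by have [od _ _ _ _] := cP => dp; exact: open_nbhs_nbhs. Qed.

Lemma nbhs_cod x : cod c x -> nbhs x (cod c).
Proof. by have [_ od _ _ _] := cP => dp; exact: open_nbhs_nbhs. Qed.

End one_chart.

Lemma local_domP M N (A : set M) (f : M -> N) (c : chart R n M) (c' : chart R n N) x :
  is_chart c ->
  local_dom A f c c' x <-> [/\ cod c x, A (bwd c x) & dom c' (f (bwd c x))].
Proof.
move=> cP; split=> [[p [[dp Ap] dfp] <-]|[cx Ax dx]].
  by split; rewrite ?fwdK//; exact: fwd_cod.
by exists (bwd c x); [split=> //; split=> //; exact: bwd_dom|exact: bwdK].
Qed.

Lemma local_dom_open M N (A : set M) (f : M -> N) (c : chart R n M)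
    (c' : chart R n N) : is_chart c -> is_chart c' -> open A ->
  {in A, continuous f} -> open (local_dom A f c c').
Proof.
move=> cP cP' oA cf; rewrite openE => x /(local_domP _ _ _ _ cP)[cx Ax dx].
have cb := bwd_continuous_at cP cx.
have nA : nbhs (bwd c x) A by exact: open_nbhs_nbhs.
have nf := cf _ (mem_set Ax) _ (nbhs_dom cP' dx).
rewrite /interior /=.
have := cb _ nA; have := cb _ nf; have := nbhs_cod cP cx.
by apply: filterS3 => y cy dy Ay; apply/local_domP.
Qed.

End charts.

Lemma closed_equalizer (T M : topologicalType) (f g : T -> M) :
  hausdorff_space M -> continuous f -> continuous g ->
  closed [set t | f t = g t].
Proof.
move=> hM cf cg t clt; apply: hM => A B nA nB.
have /clt[s [/= fgs [As Bs]]] : nbhs t (f @^-1` A `&` g @^-1` B).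
  by apply: filterI; [exact: cf|exact: cg].
by exists (f s); split=> //; rewrite fgs.
Qed.

Lemma connected_clopen (T : topologicalType) (Z : set T) :
  connected [set: T] -> open Z -> closed Z -> Z !=set0 -> Z = setT.
Proof. by move=> cT oZ cZ Z0; apply: cT => //; exists Z; rewrite ?setTI. Qed.

Section identity_theorem.
Context {R : realType} {n : nat} {M : topologicalType} (S : kahler_data R n M).
Hypothesis kS : kahler_manifold S.

Lemma holomorphic_eq_id (psi : M -> M) (W : set M) :
  connected [set: M] -> holomorphic_on S S setT psi ->
  open W -> W !=set0 -> (forall p, W p -> psi p = p) -> forall p, psi p = p.
Proof.
move=> cM [[cpsi spsi] hpsi] oW [p0 Wp0] Wid.
have cpsi' p : {for p, continuous psi} by apply: cpsi; exact/mem_set.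
pose F := [set p | psi p = p].
pose Z := interior F.
have oZ : open Z by exact: open_interior.
have cF : closed F.
  apply: closed_equalizer; [exact: km_hausdorff kS|exact: cpsi'|by move=> p; exact: cvg_id].
have cZ : closed Z.
  move=> p clp.
  have Fp : F p by apply: cF; apply: closureS clp; exact: interior_subset.
  have [c ac dp] := km_cover kS p.
  have cP := km_chart kS ac.
  pose U := local_dom setT psi c c.
  have oU : open U by apply: local_dom_open => //; exact: openT.
  have Up : U (fwd c p).
    by exists p => //; split=> //; rewrite /preimage /= Fp.
  have /nbhs_ballP[r /= r0 rU] : nbhs (fwd c p) U by exact: open_nbhs_nbhs.
  (* Vanishing propagates from q only to a quarter of the radius of a ball around q. A point q
     within r / 8 of the coordinates of p has its ball of radius r / 2 inside U, and r / 8 is a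
     quarter of that radius, so the points reached include a neighbourhood of p. *)
  have r80 : 0 < r / 8 by rewrite divr_gt0.
  have nb q : ball q (r / 8) (fwd c p) ->
      nbhs p (dom c `&` fwd c @^-1` (ball q (r / 8))).
    move=> qp; apply: filterI; first exact: nbhs_dom.
    apply: fwd_continuous_at => //; apply: open_nbhs_nbhs; split=> //.
    exact: ball_open.
  have [p1 [Zp1 [dp1 bp1]]] := clp _ (nb (fwd c p) (ballxx _ r80)).
  pose q := fwd c p1.
  have qp : ball q (r / 8) (fwd c p) by exact: ball_sym.
  apply: filterS (nb q qp) => p2 [dp2 bp2].
  have bU : ball q (r / 2) `<=` U.
    move=> y qy; apply: rU; have -> : r = r / 2 + r / 2 by field.
    apply: ball_triangle qy; apply: le_ball bp1; lra.
  pose h y := local_rep psi c c y - y.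
  have Ch : Ck 2 (ball q (r / 2)) h.
    apply: Ck_sub bU _; apply: CkB => //; last exact: Ck_id.
    exact: (spsi c c ac ac 2).
  have CRh y w : ball q (r / 2) y -> 'D_(mulI w) h y = mulI ('D_w h y).
    move=> /bU Uy.
    have D v : 'D_v h y = 'D_v (local_rep psi c c) y - v.
      rewrite deriveB ?derive_id//.
      by have [_ /(_ v)[+ _]] := spsi c c ac ac 1%N; exact.
    rewrite !D hpsi//.
    by rewrite /mulI /= opprD.
  have h0 : \forall y \near q, h y = 0.
    have nF : nbhs (bwd c q) F by rewrite fwdK.
    have cq : cod c q by exact: fwd_cod.
    have := bwd_continuous_at cP cq nF; have := nbhs_cod cP cq.
    by apply: filterS2 => y cy Fy; rewrite /h /local_rep Fy bwdK// subrr.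
  have v8 : `|fwd c p2 - q| < r / 2 / 4.
    by move: bp2; rewrite -ball_normE /ball_ /= distrC; lra.
  have := holomorphic_vanish Ch CRh h0 v8.
  rewrite addrC subrK => /eqP; rewrite subr_eq0 => /eqP E.
  have /(local_domP _ _ _ _ cP)[_ _] : U (fwd c p2).
    by apply: bU; apply: le_ball bp2; lra.
  rewrite fwdK// => dpsi; rewrite /F /= -[RHS](fwdK cP dp2) -E /local_rep.
  by rewrite fwdK// fwdK.
have ZT : Z = setT.
  apply: connected_clopen => //; exists p0.
  by rewrite /Z /interior /=; apply: filterS Wid _; exact: open_nbhs_nbhs.
by move=> p; have : Z p by [rewrite ZT]; move=> /interior_subset.
Qed.

End identity_theorem.

(** * Closed subgroups of the torus *)

Section row_vectors.
Context {R : realType} {n : nat}.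
Implicit Types (u v t : 'rV[R]_n) (e : R).

Lemma mx_norm_le u e : 0 <= e -> (forall i, `|u ord0 i| <= e) -> `|u| <= e.
Proof.
move=> e0 ue; rewrite [leLHS]mx_normrE; apply: bigmax_le => //= -[i j] _ /=.
by rewrite ord1.
Qed.

Lemma int_vecP u : reflect (forall i, u ord0 i \is a Num.int) (u \in int_vec).
Proof. exact: forallP. Qed.

Lemma int_vec_small u : u \in int_vec -> `|u| < 1 -> u = 0.
Proof.
move=> /int_vecP uZ u1; apply/rowP => i; rewrite mxE.
have := le_lt_trans (le_mx_norm u i) u1.
have /intrP[z ->] := uZ i.
rewrite -intr_norm -[1]/(1%:~R) ltr_int => z1.
by have -> : z = 0 by lia.
Qed.

Definition frac_vec t : 'rV[R]_n := \row_i (t ord0 i - (Num.floor (t ord0 i))%:~R).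

Lemma frac_vec_int t : t - frac_vec t \in int_vec.
Proof. by apply/int_vecP => i; rewrite !mxE opprB addrC subrK intr_int. Qed.

(** Pigeonhole principle by compactness of the unit cube: two multiples of t, of distinct indices,
    have fractional parts within e / 2 of the same cluster point, and their difference is the
    multiple sought. *)
Lemma dirichlet t e : 0 < e ->
  exists2 k : nat, (0 < k)%N & exists2 w, w \in int_vec & `|t *+ k - w| < e.
Proof.
move=> e0; pose B := [set v : 'rV[R]_n | forall i, `[(0 : R), 1]%classic (v ord0 i)].
have cB : compact B by apply: (@rV_compact _ _ (fun=> `[(0 : R), 1]%classic)) => i; exact: segment_compact.
pose F := filter_from [set: nat] (fun N => [set frac_vec (t *+ k) | k in [set k | (N <= k)%N]]).
have FF : ProperFilter F.
  apply: filter_from_proper; last first.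
    by move=> N _; exists (frac_vec (t *+ N)); exists N => /=.
  apply: filter_from_filter; first by exists 0%N.
  move=> i j _ _; exists (maxn i j) => // _ [k /= + <-].
  by rewrite geq_max => /andP[ik jk]; split; exists k.
have FB : F B.
  exists 0%N => // _ [k _ <-] i; rewrite /frac_vec mxE /= in_itv /=.
  by have := floor_itv ((t *+ k) ord0 i); rewrite intrD; lra.
have [z [_ clz]] := cB F FF FB.
have e20 : 0 < e / 2 by rewrite divr_gt0.
have hit N : exists2 k, (N <= k)%N & `|z - frac_vec (t *+ k)| < e / 2.
  have [_ [[k /= Nk <-]]] : [set frac_vec (t *+ k) | k in [set k | (N <= k)%N]]
     `&` ball z (e / 2) !=set0.
    by apply: clz; [exists N|exact: nbhsx_ballx].
  by rewrite -ball_normE /ball_ /= => zk; exists k.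
have [k _ zk] := hit 0%N; have [l kl zl] := hit k.+1.
exists (l - k)%N; first by rewrite subn_gt0.
exists ((t *+ l - frac_vec (t *+ l)) - (t *+ k - frac_vec (t *+ k))).
  by rewrite rpredB// frac_vec_int.
rewrite mulrnBr; last exact: ltnW.
have -> : t *+ l - t *+ k - (t *+ l - frac_vec (t *+ l) - (t *+ k - frac_vec (t *+ k))) =
   (z - frac_vec (t *+ k)) - (z - frac_vec (t *+ l)).
  by apply/rowP => i; rewrite !mxE; ring.
by rewrite (le_lt_trans (ler_normB _ _))// [e]splitr ltrD.
Qed.

Lemma two_adic u : u \in int_vec -> u != 0 ->
  exists j v, [/\ v \in int_vec, 2^-1 *: v \notin int_vec & u = v *+ 2 ^ j].
Proof.
have [m] : exists m : nat, `|u| < 2 ^+ m.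
  exists (Num.bound `|u|); rewrite -natrX.
  by rewrite (lt_trans (archi_boundP (normr_ge0 _)))// ltr_nat ltn_expl.
elim: m u => [|m IH] u.
  by rewrite expr0 => u1 uZ; rewrite (int_vec_small uZ u1) eqxx.
move=> um uZ u0; have [u2|u2] := boolP (2^-1 *: u \in int_vec); last first.
  by exists 0%N, u; rewrite expn0 mulr1n.
have [|//||j [v [vZ v2 E]]] := IH (2^-1 *: u).
- rewrite normrZ gtr0_norm ?invr_gt0// mulrC ltr_pdivrMr//.
  by rewrite -exprSr.
- by rewrite scaler_eq0 negb_or u0 invr_eq0 pnatr_eq0.
exists j.+1, v; split=> //.
by rewrite expnS mulnC mulrnA -E -scaler_nat scalerA divff ?scale1r// pnatr_eq0.
Qed.

(** Representatives of the solutions of 2x = 0 in the torus. That they form a finite family allows a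
    bound on their distance to a closed set that is uniform in b. *)
Definition half_vec (b : {ffun 'I_n -> bool}) : 'rV[R]_n :=
  \row_i (if b i then 2^-1 else 0).

Lemma half_vec_mod u : u \in int_vec ->
  exists b, 2^-1 *: u - half_vec b \in int_vec.
Proof.
move=> /int_vecP uZ; exists [ffun i => 2^-1 * u ord0 i \isn't a Num.int].
apply/int_vecP => i; rewrite !mxE ffunE; case: ifPn => [|/negbNE]; last by rewrite subr0.
have /intrP[z ->] := uZ i => nZ.
have Ez := divz_eq z 2.
have [z2|z2] : (z %% 2)%Z = 0 \/ (z %% 2)%Z = 1.
  by have := modz_ge0 z (isT : 2 != 0 :> int); have := ltz_mod z (isT : 2 != 0 :> int); lia.
  by case/negP: nZ; rewrite Ez z2 addr0 intrM mulrC mulfK ?intr_int.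
rewrite Ez z2 intrD intrM.
have -> (q : R) : 2^-1 * (q * 2 + 1) - 2^-1 = q by field.
exact: intr_int.
Qed.

(** If no positive multiple of t is integral, H contains arbitrarily short nonzero vectors u. The
    multiples of u follow a line that returns close to an integer vector v = 2^j v' with v'/2 not
    integral; at the fraction 1/2^(j+1) of the way they pass near v'/2, which has order 2 in the
    torus. Hence the closed set H must contain a point of order 2. *)
Lemma closed_subgroup_torsion (H : set 'rV[R]_n) t : closed H ->
  (forall u v, H u -> H v -> H (u - v)) -> (forall w, w \in int_vec -> H w) ->
  H t -> t \notin int_vec ->
  exists (m : nat) (w : 'rV[R]_n), [/\ w \in int_vec, H (m.+1%:R^-1 *: w) &
    m.+1%:R^-1 *: w \notin int_vec].
Proof.
move=> cH HB HZ Ht tZ.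
have H0 : H 0 by apply: HZ; rewrite rpred0.
have HN u : H u -> H (- u) by move=> Hu; rewrite -sub0r; exact: HB.
have HD u v : H u -> H v -> H (u + v) by move=> Hu Hv; rewrite -[v]opprK; exact/HB/HN.
have HM u k : H u -> H (u *+ k).
  by move=> Hu; elim: k => [|k IH]; rewrite ?mulr0n// mulrS; exact: HD.
have [[k k0 tk]|notors] := pselect (exists2 k : nat, (0 < k)%N & t *+ k \in int_vec).
  case: k k0 tk => // k _ tk; exists k, (t *+ k.+1).
  have -> : k.+1%:R^-1 *: (t *+ k.+1) = t.
    by rewrite -(scaler_nat k.+1 t) scalerA mulVf ?scale1r// pnatr_eq0.
  by split.
have [[b [bZ Hb]]|nob] := pselect (exists b, half_vec b \notin int_vec /\ H (half_vec b)).
  exists 1%N, (2 *: half_vec b); rewrite scalerA mulVf ?scale1r ?pnatr_eq0//; split=> //.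
  apply/int_vecP => i; rewrite !mxE; case: ifP => _; last by rewrite mulr0 rpred0.
  by rewrite divff ?pnatr_eq0// rpred1.
exfalso.
(* Each point of order 2 lies outside the closed set H, hence at positive distance from it;
   finiteness of the family yields one distance e for all. *)
have : \forall e \near (0 : R)^'+, forall b : {ffun 'I_n -> bool},
    half_vec b \notin int_vec -> forall y, H y -> e <= `|half_vec b - y|.
  apply: filter_forall => b.
  have [bZ|bZ] := boolP (half_vec b \in int_vec); first exact: nearW.
  have /nbhs_ballP[d /= d0 Hd] : nbhs (half_vec b) (~` H).
    by apply: open_nbhs_nbhs; split; [exact: closed_openC|move=> Hb; apply: nob; exists b].
  near=> e.
  have ed : e < d by near: e; exact: nbhs_right_lt.
  move=> _ y Hy; rewrite leNgt; apply/negP => ye.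
  by apply: (Hd y) => //; rewrite -ball_normE /ball_ /= (lt_trans ye).
move=> sep.
have [e [e0 e1 He]] : exists e : R, [/\ 0 < e, e < 1 & forall b : {ffun 'I_n -> bool},
    half_vec b \notin int_vec -> forall y, H y -> e <= `|half_vec b - y|].
  near (0 : R)^'+ => e; exists e; split.
  - by near: e; exact: nbhs_right_gt.
  - by near: e; exact: nbhs_right_lt.
  - by near: e; exact: sep.
have e20 : 0 < e / 2 by rewrite divr_gt0.
have [k k0 [w wZ kw]] := dirichlet t e20.
pose u := t *+ k - w.
have Hu : H u by apply: HB; [exact: HM|exact: HZ].
have u0 : 0 < `|u|.
  rewrite normr_gt0 subr_eq0; apply/eqP => E.
  by apply: notors; exists k => //; rewrite E.
have ue : `|u| < e / 2 by [].
clearbody u.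
(* Dirichlet's lemma applied to u itself might return the integer vector 0. A multiple [u *+ K] of
   norm at least 1 excludes this, since its further multiples stay farther than e / 2 from 0. *)
pose K := Num.bound (`|u|^-1).
have Ku : 1 <= `|u *+ K|.
  rewrite normrMn -mulr_natl -ler_pdivrMr// div1r ltW//.
  by apply: archi_boundP; rewrite invr_ge0.
clearbody K.
have [l l0 [v vZ lv]] := dirichlet (u *+ K) e20.
have v0 : v != 0.
  apply/eqP => v0; move: lv; rewrite v0 subr0 ltNge => /negP; apply.
  rewrite normrMn (@le_trans _ _ 1)//; first lra.
  by rewrite (le_trans Ku)// -[leRHS]mulr_natl ler_peMl// ler1n.
have [j [v' [vZ' v2 vE]]] := two_adic vZ v0.
have [b bZ] := half_vec_mod vZ'.
have b0 : half_vec b \notin int_vec.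
  by apply: contra v2 => b0; rewrite -(subrK (half_vec b) (_ *: v')) rpredD.
pose L := (K * l)%N; pose D := (2 ^ j.+1)%N.
(* L u is within e / 2 of v = 2^j v', so (L / D) u is close to v'/2 for D = 2^(j+1). Rounding L / D
   down to an integer keeps the point in H and adds an error below |u| < e / 2; the integral
   correction moves v'/2 to [half_vec b]. *)
pose y := u *+ (L %/ D) - (2^-1 *: v' - half_vec b).
have Hy : H y by apply: HB; [exact: HM|exact: HZ].
have := He b b0 y Hy; rewrite leNgt => /negP; apply.
have D0 : 0 < D%:R :> R by rewrite ltr0n expn_gt0.
have -> : half_vec b - y = D%:R^-1 *: (u *+ (L %% D) - (u *+ K *+ l - v)).
  have EL : L%:R = (L %/ D)%:R * D%:R + (L %% D)%:R :> R.
    by rewrite {1}(divn_eq L D) natrD natrM.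
  have ED : D%:R = 2 * (2 ^ j)%:R :> R by rewrite /D expnS natrM.
  have j0 : (2 ^ j)%:R != 0 :> R by rewrite pnatr_eq0 expn_eq0.
  rewrite /y -mulrnA -/L vE; apply/rowP => i.
  rewrite !(mxE, mulmxnE) -![u _ _ *+ _]mulr_natr -[v' _ _ *+ _]mulr_natr EL ED.
  by field.
rewrite normrZ gtr0_norm ?invr_gt0// mulrC ltr_pdivrMr//.
rewrite (le_lt_trans (ler_normB _ _))// [e]splitr mulrDl ler_ltD//.
  rewrite normrMn -[`|u| *+ _]mulr_natr ler_pM// ?ler_nat; first exact: ltW.
  by rewrite ltnW// ltn_pmod// expn_gt0.
by rewrite (lt_le_trans lv)// ler_peMr ?(ltW e20)// ler1n expn_gt0.
Unshelve. all: by end_near. Qed.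

End row_vectors.

(** * Free points are open and dense *)

Lemma compact_baire (T : topologicalType) (F : nat -> set T) (O : set T) :
  hausdorff_space T -> compact [set: T] ->
  (forall i, closed (F i)) -> (forall i, interior (F i) = set0) ->
  open O -> O !=set0 -> exists2 x, O x & forall i, ~ F i x.
Proof.
move=> hT cT cF iF oO O0.
(* The requirements on W' are conditional on W being open and nonempty, so that a choice function
   exists on all pairs; the invariant is recovered along the sequence in [WP]. *)
have next (iW : nat * set T) : exists W' : set T, open iW.2 -> iW.2 !=set0 ->
    [/\ open W', W' !=set0 & closure W' `<=` iW.2 `\` F iW.1].
  case: iW => i W /=.
  have [[oW W0]|nW] := pselect (open W /\ W !=set0); last first.
    by exists set0 => ? ?; case: nW.
  have oWF : open (W `\` F i) by rewrite setDE; apply: openI => //; exact: closed_openC.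
  have [x WFx] : W `\` F i !=set0.
    apply/set0P/eqP; rewrite setD_eq0 => WF.
    case: W0 => x Wx; have : interior (F i) x.
      by rewrite /interior /=; apply: filterS WF _; exact: open_nbhs_nbhs.
    by rewrite iF.
  have nx : nbhs x (W `\` F i) by exact: open_nbhs_nbhs.
  have [V nV clV] := compact_regular hT cT (@filterT _ (nbhs x) _) nx.
  exists (interior V) => _ _; split; first exact: open_interior.
    by exists x.
  by apply: subset_trans clV; apply: closureS; exact: interior_subset.
have {next} [g gP] := choice next.
pose W := fix W i := if i is j.+1 then g (j, W j) else O.
have WP i : open (W i) /\ W i !=set0.
  by elim: i => [|i [oW W0]] //=; have [] := gP (i, W i) oW W0.
have clW i : closure (W i.+1) `<=` W i `\` F i.
  by have [oW W0] := WP i; have [] := gP (i, W i) oW W0.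
have Wle i j : (i <= j)%N -> W j `<=` W i.
  move=> /subnK <-; elim: (j - i)%N => [//|k IH]; rewrite addSn.
  apply: subset_trans IH; apply: subset_trans (@subset_closure _ _) _.
  by apply: subset_trans (clW _) _; exact: subDsetl.
pose G := filter_from [set: nat] W.
have GF : ProperFilter G.
  apply: filter_from_proper; last by move=> i _; have [] := WP i.
  apply: filter_from_filter; first by exists 0%N.
  move=> i j _ _; exists (maxn i j) => // x Wx.
  by split; apply: Wle Wx; rewrite ?leq_maxl ?leq_maxr.
have [x [_ clx]] := cT G GF (@filterT _ G _).
have xW i : W i x /\ ~ F i x.
  apply: (clW i); move=> B nB; apply: clx => //; by exists i.+1.
by exists x => [|i]; [case: (xW 0%N)|case: (xW i)].
Qed.

Section torus_pi.
Context {R : realType} {n : nat}.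
Implicit Types s t : 'rV[R]_n.

Lemma torus_piB s t : torus_pi (s - t) = torus_pi s - torus_pi t.
Proof. exact: (pi_is_zmod_morphism (Quotient.quot (int_lattice R n))). Qed.

Lemma torus_pi_eq0 t : (torus_pi t == 0) = (t \in int_vec).
Proof.
have <- : torus_pi (0 : 'rV[R]_n) = 0 by have := torus_piB 0 0; rewrite !subrr.
by rewrite -[t in RHS]subr0 (Quotient.idealrBE (int_lattice R n)).
Qed.

Lemma torus_piP (a : torus R n) : exists t, a = torus_pi t.
Proof. by exists (repr a); rewrite /torus_pi reprK. Qed.

End torus_pi.

Section free_points.
Context {R : realType} {n : nat} {M : topologicalType}.
Variables (S : kahler_data R n M) (Phi : torus R n -> M -> M).
Hypothesis toricM : kahler_toric S Phi.

(** The stabilizer is lifted to R^n, where it is a closed subgroup containing the integer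
    vectors. *)
Let stab (p : M) : set 'rV[R]_n := [set t | Phi (torus_pi t) p = p].

Let hM : hausdorff_space M := km_hausdorff (kt_kahler toricM).

Let cPhi : continuous (fun tp : 'rV[R]_n * M => Phi (torus_pi tp.1) tp.2) :=
  (kt_smooth toricM).1.

Let stab_closed p : closed (stab p).
Proof.
apply: closed_equalizer => //; last exact: cst_continuous.
move=> t; apply: (@continuous_comp _ _ _ (fun t => (t, p))
  (fun tp : 'rV[R]_n * M => Phi (torus_pi tp.1) tp.2)); last exact: cPhi.
move=> A [[B1 B2] [/= n1 n2] sub]; apply: filterS n1 => s Bs; apply: sub.
by split=> //; exact: nbhs_singleton.
Qed.

Let stab_int p w : w \in int_vec -> stab p w.
Proof.
by rewrite -torus_pi_eq0 /stab /= => /eqP ->; have [-> _] := kt_action toricM.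
Qed.

Let stabB p u v : stab p u -> stab p v -> stab p (u - v).
Proof.
have [Phi0 PhiD] := kt_action toricM; rewrite /stab /= torus_piB => Hu Hv.
have Hv' : Phi (- torus_pi v) p = p by rewrite -{1}Hv -PhiD addNr Phi0.
by rewrite PhiD Hv'.
Qed.

Let nonfreeP p : ~ free_points Phi p <-> exists2 t, stab p t & t \notin int_vec.
Proof.
split=> [nf|[t Ht tZ] fp]; last first.
  by move: tZ; rewrite -torus_pi_eq0 => /eqP; apply; exact: fp.
apply: contrapT => nt; apply: nf => a; have [t ->] := torus_piP a => Ht.
apply/eqP; rewrite torus_pi_eq0; apply: contrapT => /negP tZ.
by apply: nt; exists t.
Qed.

(** Rounding each coordinate to a nearest integer gives a nonzero representative of norm at most
    1/2, and doubling it while its norm is below 1/4 never exceeds 1/2. Nontrivial stabilizers are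
    thus detected on a compact set of vectors that excludes 0. *)
Let stab_norm p t : stab p t -> t \notin int_vec ->
  exists2 s, stab p s & 4^-1 <= `|s| <= 2^-1.
Proof.
move=> Ht tZ.
have [s [Hs s0 s2]] : exists s, [/\ stab p s, s != 0 & `|s| <= 2^-1].
  pose w : 'rV[R]_n := \row_i (Num.floor (t ord0 i + 2^-1))%:~R.
  have wZ : w \in int_vec by apply/int_vecP => i; rewrite mxE intr_int.
  exists (t - w); split.
  - by apply: stabB => //; exact: stab_int.
  - by rewrite subr_eq0; apply: contraNneq tZ => ->.
  - apply: mx_norm_le; first by rewrite invr_ge0.
    move=> i; rewrite !mxE ler_norml.
    by have := floor_itv (t ord0 i + 2^-1); rewrite intrD; lra.
have [m] : exists m : nat, 4^-1 <= `|s| * 2 ^+ m.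
  exists (Num.bound `|s|^-1).
  have s1 : 0 < `|s| by rewrite normr_gt0.
  rewrite -ler_pdivrMl// -natrX (@le_trans _ _ `|s|^-1)//.
    by rewrite ler_piMr ?invr_ge0// invf_le1//; lra.
  have si : 0 <= `|s|^-1 by rewrite invr_ge0.
  by rewrite ltW// (lt_trans (archi_boundP si))// ltr_nat ltn_expl.
elim: m s Hs s2 {s0} => [|m IH] s Hs s2.
  by rewrite expr0 mulr1 => s4; exists s => //; rewrite s4.
have [s4 _|s4] := lerP 4^-1 `|s|; first by exists s => //; rewrite s4.
rewrite exprS mulrA => sm; apply: (IH (s + s)).
- rewrite -[X in _ + X]opprK; apply: stabB => //.
  by rewrite -sub0r; apply: stabB => //; apply: stab_int; rewrite rpred0.
- by rewrite (le_trans (ler_normD _ _))//; lra.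
- by rewrite (_ : `|s + s| = `|s| * 2)// -mulr2n normrMn mulr_natr.
Qed.

(** The points with nontrivial stabilizer are the projection to M of a closed part of a compact
    product, hence a compact set, closed because M is Hausdorff. *)
Lemma free_points_open : open (free_points Phi).
Proof.
pose C := [set t : 'rV[R]_n | 4^-1 <= `|t| <= 2^-1].
have cnorm : continuous (fun t : 'rV[R]_n => `|t|) by exact: norm_continuous.
have cC : compact C.
  apply: (@subclosed_compact _ C
    [set v : 'rV[R]_n | forall i, `[(-1 : R), 1]%classic (v ord0 i)]).
  - have -> : C = (fun t : 'rV[R]_n => `|t|) @^-1` `[4^-1, 2^-1]%classic.
      by apply/seteqP; split=> z; rewrite /C /= in_itv.
    by apply: preimage_closed => //; exact: interval_closed.
  - by apply: (@rV_compact _ _ (fun=> `[(-1 : R), 1]%classic)) => i; exact: segment_compact.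
  - move=> t /andP[_ t2] i /=; rewrite in_itv /= -ler_norml.
    by rewrite (le_trans (le_mx_norm t i))//; lra.
pose D := [set tp : 'rV[R]_n * M | Phi (torus_pi tp.1) tp.2 = tp.2].
have cD : closed D.
  by apply: closed_equalizer => // tp; exact: cvg_snd.
have cCM : compact ((C `*` [set: M]) `&` D).
  by apply: compact_closedI => //; exact: compact_setX cC (kt_compact toricM).
have -> : free_points Phi = ~` (snd @` ((C `*` [set: M]) `&` D)).
  apply/seteqP; split=> [p fp [[t q] [[/= /andP[t4 t2] _] Dt] /= qp]|p np].
    subst q; suff : ~ free_points Phi p by [].
    apply/nonfreeP; exists t => //; apply/negP => tZ.
    have t0 : t = 0 by apply: (int_vec_small tZ); rewrite (le_lt_trans t2)//; lra.
    by move: t4; rewrite t0 normr0; lra.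
  apply: contrapT => /nonfreeP[t Ht /(stab_norm Ht)[s Hs sC]].
  by apply: np; exists (s, p).
apply: closed_openC; apply: compact_closed => //.
apply: continuous_compact => //; apply: continuous_subspaceT.
by move=> tp; exact: cvg_snd.
Qed.

Lemma free_points_dense : dense (free_points Phi).
Proof.
move=> O O0 oO.
pose q (k : 'rV[int]_n * nat) : 'rV[R]_n := k.2.+1%:R^-1 *: map_mx intr k.1.
(* An enumeration of the fixed sets of the torsion elements [q k]. Codes that decode to nothing, or
   to an integral vector, which acts trivially, receive the empty set, so that every F i has empty
   interior. *)
pose F (i : nat) : set M := if unpickle i is Some k then
  if q k \in int_vec then set0 else [set p | stab p (q k)] else set0.
have [i|i|p Op nF] := @compact_baire M F O hM (kt_compact toricM) _ _ oO O0.
- rewrite /F; case: unpickle => [k|]; last exact: closed0.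
  case: ifPn => _; first exact: closed0.
  apply: closed_equalizer => //; last by move=> p; exact: cvg_id.
  move=> p; have [[+ _ _] _ _] := kt_aut toricM (torus_pi (q k)).
  by move=> [+ _]; apply; exact/mem_set.
- rewrite /F; case: unpickle => [k|]; last by rewrite interior0.
  case: ifPn => qZ; first by rewrite interior0.
  apply/eqP; apply: contrapT => /negP/set0P ne.
  have [_ hol _] := kt_aut toricM (torus_pi (q k)).
  have := holomorphic_eq_id (kt_kahler toricM) (kt_connected toricM) hol
    (open_interior _) ne.
  move=> /(_ (fun p pi => interior_subset pi)) /(kt_effective toricM)/eqP.
  by rewrite torus_pi_eq0; exact/negP.
exists p; split=> //; apply: contrapT => /nonfreeP[t Ht tZ].
have [m [w [wZ Hw qZ]]] := closed_subgroup_torsion (@stab_closed p) (@stabB p)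
  (@stab_int p) Ht tZ.
pose k : 'rV[int]_n * nat := (\row_i Num.floor (w ord0 i), m).
have qk : q k = m.+1%:R^-1 *: w.
  rewrite /q /=; congr (_ *: _); apply/rowP => i; rewrite !mxE.
  by have /int_vecP/(_ i)/intrP[z ->] := wZ; rewrite intrKfloor.
by apply: (nF (pickle k)); rewrite /F pickleK qk (negbTE qZ).
Qed.

End free_points.

(** * Charts of the quotient of the tangent bundle *)

Section parallel_frames.
Context {R : realType} {n : nat}.
Implicit Types (Y : 'I_n -> 'rV[R]_n -> 'rV[R]_n) (u v : Cspace R n).

Lemma parallel_cst (Z : 'rV[R]_n -> 'rV[R]_n) theta : parallel Z -> Z theta = Z 0.
Proof.
move=> [sZ dZ]; apply/rowP => j.
rewrite -[theta]add0r; apply: (@derive0_cst R _ (fun t => Z t ord0 j)) => t _.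
have dd : derivable Z (0 + t *: theta) theta.
  by have [_ /(_ theta)[+ _]] := sZ 1%N; apply.
apply: DeriveDef; first by move/derivable_mxP : dd; exact.
by have := dZ (0 + t *: theta) theta; rewrite derive_mx// => /rowP/(_ j); rewrite !mxE.
Qed.

Variable Y : 'I_n -> 'rV[R]_n -> 'rV[R]_n.
Hypothesis YP : parallel_frame Y.

Let YM : 'M[R]_n := \matrix_(i < n) Y i 0.

Let translateE t u : translate Y t u = (u.1, u.2 + t *m YM).
Proof.
rewrite /translate mulmx_sum_row; congr (_, _ + _).
apply: eq_bigr => i _; rewrite rowK; congr (_ *: _).
by apply: parallel_cst; exact: YP.1.
Qed.

Let discrete : exists2 d : R, 0 < d &
  forall k, k \in int_vec -> `|k *m YM| < d -> k = 0.
Proof.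
(* From k = (k YM) B one gets |k| <= |k YM| (C - 1), which is below 1 as soon as |k YM| < 1/C; the
   summand 1 keeps C positive. *)
pose B := invmx YM; pose C := \sum_i \sum_j `|B i j| + 1.
have C0 : 0 < C by rewrite ltr_wpDl// sumr_ge0// => i _; rewrite sumr_ge0.
exists C^-1; first by rewrite invr_gt0.
move=> k kZ kd; apply: int_vec_small kZ _.
have -> : k = (k *m YM) *m B by rewrite -mulmxA mulmxV ?mulmx1//; exact: YP.2.
move: (k *m YM) kd => w wd.
rewrite (@le_lt_trans _ _ (`|w| * (C - 1)))//; last first.
  rewrite (@le_lt_trans _ _ (C^-1 * (C - 1)))//.
    by rewrite ler_wpM2r ?(ltW wd)// subr_ge0 lerDr sumr_ge0// => i _; rewrite sumr_ge0.
  by rewrite mulrBr mulVf ?gt_eqF// mulr1 gtrBl invr_gt0.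
rewrite addrK; apply: mx_norm_le.
  by rewrite mulr_ge0// sumr_ge0// => i _; rewrite sumr_ge0.
move=> j; rewrite mxE (le_trans (ler_norm_sum _ _ _))// mulr_sumr ler_sum// => i _.
rewrite normrM ler_pM ?le_mx_norm//.
by rewrite (bigD1 j)//= lerDl sumr_ge0.
Qed.

Lemma qLP u v : qL Y u = qL Y v <-> exists2 k, k \in int_vec & v = translate Y k u.
Proof.
split=> [|[k kZ E]].
  move=> /(f_equal (fun z => (z : {eq_quot (lattice_equiv Y)}%qT)))/eqP.
  by rewrite eqmodE => /asboolP.
apply: (eqP (T := {eq_quot (lattice_equiv Y)}%qT)); rewrite eqmodE.
by apply/asboolP; exists k.
Qed.

Lemma qL_continuous : continuous (qL Y).
Proof. exact: pi_continuous. Qed.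

Lemma qL_open (O : set (Cspace R n)) : open O -> open (qL Y @` O).
Proof.
move=> oO.
suff : open (qL Y @^-1` (qL Y @` O)) by [].
rewrite openE => v [u Ou /esym/qLP[k kZ E]].
have ct : {for v, continuous (translate Y k)}.
  rewrite /prop_for /continuous_at (_ : translate Y k = (fun u => u + (0, k *m YM))).
    by apply: cvgD; [exact: cvg_id|exact: cvg_cst].
  apply/funext => w; rewrite translateE [RHS]surjective_pairing /=.
  by rewrite addr0.
have nO : nbhs (translate Y k v) O by rewrite -E; exact: open_nbhs_nbhs.
apply: (@filterS _ (nbhs v) _ (translate Y k @^-1` O)); last exact: ct.
by move=> w Ow; exists (translate Y k w) => //; apply/esym/qLP; exists k.
Qed.

(** Two points of a ball of radius d / 2 differ by less than d, a lower bound for the nonzero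
    lattice vectors; q_L is therefore injective on the ball and, being open, has a continuous
    inverse there. *)
Lemma qL_section u0 : exists c : chart R n (EL Y),
  [/\ is_chart c, bwd c = qL Y, cod c u0 & forall u, cod c u -> fwd c (qL Y u) = u].
Proof.
have [d d0 dP] := discrete.
pose B := ball u0 (d / 2).
have d20 : 0 < d / 2 by rewrite divr_gt0.
have inj u v : B u -> B v -> qL Y u = qL Y v -> u = v.
  move=> Bu Bv /qLP[k kZ E]; rewrite E.
  suff -> : k = 0 by rewrite translate0.
  apply: dP => //.
  have -> : k *m YM = v.2 - u.2 by rewrite E translateE /= addrC addKr.
  have : `|v - u| < d.
    have -> : v - u = (u0 - u) - (u0 - v) by rewrite opprB [RHS]addrC addrA subrK.
    rewrite [d]splitr (le_lt_trans (ler_normB _ _))// ltrD//.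
      by move: Bu; rewrite /B -ball_normE.
    by move: Bv; rewrite /B -ball_normE.
  by apply: le_lt_trans; rewrite prod_normE le_max lexx orbT.
(* The default value u0 is taken only outside the image of the ball, that is outside the domain of
   the chart. *)
pose s (z : EL Y) := xget u0 [set u | B u /\ qL Y u = z].
have sK u : B u -> s (qL Y u) = u.
  move=> Bu; rewrite /s; case: xgetP => [v _ [Bv vu]|/(_ u)]; first exact: inj.
  by case.
pose c : chart R n (EL Y) := Chart (qL Y @` B) s (qL Y).
have codE : cod c = B.
  apply/seteqP; split=> [_ [_ [u Bu <-] <-]|u Bu] /=; first by rewrite sK.
  by exists (qL Y u); [exists u|exact: sK].
have oB : open B by exact: ball_open.
exists c; split=> //; last 2 first.
- by rewrite codE; exact: ballxx.
- by move=> u; rewrite codE; exact: sK.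
split.
- exact: qL_open.
- by rewrite codE.
- by move=> z /set_mem[u Bu <-] /=; rewrite sK.
- rewrite continuous_open_subspace; last exact: qL_open.
  move=> z /set_mem[u Bu <-] A /=; rewrite sK// => nA.
  have nAB : nbhs u (A `&` B) by apply: filterI => //; exact: open_nbhs_nbhs.
  rewrite /nbhs /=.
  apply: (@filterS _ (nbhs (qL Y u)) _ (qL Y @` (interior (A `&` B)))).
    move=> _ [v /interior_subset[Av Bv] <-].
    by rewrite /= sK.
  apply: open_nbhs_nbhs; split; first by apply: qL_open; exact: open_interior.
  by exists u.
- rewrite codE continuous_open_subspace// => u _; exact: qL_continuous.
Qed.

End parallel_frames.

(** * Local isometries *)

Section differentiable_extra.
Context {R : realType}.

Lemma near_eq_differentiable (V W : normedModType R) (f g : V -> W) (x : V) :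
  (\forall y \near x, f y = g y) -> differentiable f x -> differentiable g x.
Proof.
move=> fg df; have fgx := nbhs_singleton fg.
apply: (@differentiable_eps R V W g x ('d f x)); first exact: diff_continuous.
move=> e e0; have /eqaddoP/(_ e e0) := diff_locally df.
have nfg : \forall h \near (0 : V), f (h + x) = g (h + x).
  have : (fun h : V => h + x) @ (0 : V) --> x.
    by rewrite -[X in _ --> X]add0r; apply: cvgD; [exact: cvg_id|exact: cvg_cst].
  by move=> /(_ _ fg).
by apply: filterS2 nfg => h E; rewrite !fctE /= E fgx.
Qed.

Lemma derive_chain (U V W : normedModType R) (f : U -> V) (g : V -> W) (x v : U) :
  differentiable f x -> differentiable g (f x) ->
  'D_v (fun y => g (f y)) x = 'D_('D_v f x) g (f x).
Proof.
move=> df dg; rewrite deriveE; last exact: differentiable_comp.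
by rewrite diff_comp// deriveE// deriveE.
Qed.

End differentiable_extra.

Section local_isometries.
Context {R : realType} {n : nat}.
Implicit Types M N P : topologicalType.

(** The covering by charts contained in [kahler_manifold]; the quotient E_L has it through the local
    sections of q_L, which puts E_L and N on the same footing. *)
Definition charted {M} (S : kahler_data R n M) :=
  (forall c, atlas S c -> is_chart c) /\
  (forall p, exists2 c, atlas S c & dom c p).

Definition differentiable_rep {M N} (S : kahler_data R n M) (T : kahler_data R n N)
    (f : M -> N) (p : M) :=
  {for p, continuous f} /\
  forall c c', atlas S c -> atlas T c' -> dom c p -> dom c' (f p) ->
    differentiable (local_rep f c c') (fwd c p).

(** Stated at one point, so that it composes with inverses of parametrizations, which are meaningful
    only over the free points. *)
Definition local_isometry {M N} (S : kahler_data R n M) (T : kahler_data R n N)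
    (f : M -> N) (p : M) :=
  differentiable_rep S T f p /\
  forall c c', atlas S c -> atlas T c' -> dom c p -> dom c' (f p) -> forall u v,
    metric S c (fwd c p) u v =
    metric T c' (fwd c' (f p)) ('D_u (local_rep f c c') (fwd c p))
      ('D_v (local_rep f c c') (fwd c p)).

Lemma kahler_charted {M} (S : kahler_data R n M) : kahler_manifold S -> charted S.
Proof. by move=> kS; split; [exact: km_chart kS|exact: km_cover kS]. Qed.

Section two_manifolds.
Context {M N : topologicalType} (S : kahler_data R n M) (T : kahler_data R n N).
Hypotheses (cS : charted S) (cT : charted T).

Lemma smooth_differentiable_rep (A : set M) (f : M -> N) p :
  open A -> smooth_on S T A f -> A p -> differentiable_rep S T f p.
Proof.
move=> oA [cf sf] Ap; split; first by apply: cf; exact/mem_set.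
move=> c c' ac ac' dp dfp; apply: (@Ck1_differentiable R n (local_dom A f c c')).
- by apply: local_dom_open => //; [exact: cS.1|exact: cT.1].
- by exists p.
- exact: (sf c c' ac ac' 1%N).
Qed.

Lemma isometric_local_isometry (A : set M) (f : M -> N) p :
  open A -> smooth_on S T A f -> isometric_on S T A f -> A p ->
  local_isometry S T f p.
Proof.
move=> oA sf If Ap; split; first exact: smooth_differentiable_rep sf Ap.
move=> c c' ac ac' dp dfp u v; rewrite (If c c' ac ac' (fwd c p)); last by exists p.
by rewrite /local_rep fwdK//; exact: cS.1.
Qed.

End two_manifolds.

Section composition.
Context {M N P : topologicalType}.
Context (S : kahler_data R n M) (T : kahler_data R n N) (Q : kahler_data R n P).
Hypotheses (cS : charted S) (cT : charted T).

Lemma near_local_rep (f : M -> N) (g : N -> P) p c c' c'' :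
  atlas S c -> atlas T c' -> dom c p -> dom c' (f p) -> {for p, continuous f} ->
  \forall y \near fwd c p,
    local_rep g c' c'' (local_rep f c c' y) = local_rep (g \o f) c c'' y.
Proof.
move=> ac ac' dp dfp cf.
have nb : nbhs (bwd c (fwd c p)) (f @^-1` dom c').
  by rewrite (fwdK (cS.1 _ ac) dp); apply: cf; apply: nbhs_dom => //; exact: cT.1.
have : nbhs (fwd c p) (bwd c @^-1` (f @^-1` dom c')).
  exact: (bwd_continuous_at (cS.1 _ ac) (fwd_cod dp) nb).
apply: filterS => y dy.
by rewrite /local_rep (fwdK (cT.1 _ ac') dy).
Qed.

Lemma local_rep_fwd (f : M -> N) p c c' : atlas S c -> dom c p ->
  local_rep f c c' (fwd c p) = fwd c' (f p).
Proof. by move=> ac dp; rewrite /local_rep fwdK//; exact: cS.1. Qed.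

Lemma differentiable_rep_comp (f : M -> N) (g : N -> P) p :
  differentiable_rep S T f p -> differentiable_rep T Q g (f p) ->
  differentiable_rep S Q (g \o f) p.
Proof.
move=> [cf df] [cg dg]; split; first exact: continuous_comp.
move=> c c'' ac ac'' dp dgp; have [c' ac' dfp] := cT.2 (f p).
apply: near_eq_differentiable (near_local_rep g c'' ac ac' dp dfp cf) _.
apply: differentiable_comp; first exact: df.
by rewrite local_rep_fwd//; exact: dg.
Qed.

Lemma derive_rep_comp (f : M -> N) (g : N -> P) p c c' c'' u :
  differentiable_rep S T f p -> differentiable_rep T Q g (f p) ->
  atlas S c -> atlas T c' -> atlas Q c'' ->
  dom c p -> dom c' (f p) -> dom c'' (g (f p)) ->
  'D_u (local_rep (g \o f) c c'') (fwd c p) =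
  'D_('D_u (local_rep f c c') (fwd c p)) (local_rep g c' c'') (fwd c' (f p)).
Proof.
move=> [cf df] [cg dg] ac ac' ac'' dp dfp dgp.
rewrite -(near_eq_derive u (near_local_rep g c'' ac ac' dp dfp cf)).
rewrite derive_chain; [|exact: df|]; rewrite local_rep_fwd//; exact: dg.
Qed.

Lemma local_isometry_comp (f : M -> N) (g : N -> P) p :
  local_isometry S T f p -> local_isometry T Q g (f p) ->
  local_isometry S Q (g \o f) p.
Proof.
move=> [df If] [dg Ig]; split; first exact: differentiable_rep_comp.
move=> c c'' ac ac'' dp dgp u v; have [c' ac' dfp] := cT.2 (f p).
rewrite (If _ _ ac ac' dp dfp) (Ig _ _ ac' ac'' dfp dgp).
by rewrite !(derive_rep_comp _ df dg ac ac' ac'' dp dfp dgp).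
Qed.

End composition.

(** The chain rule for f o g = id near q shows that the derivative of f undoes that of g, so the
    isometry identity of f at g q, read on the images of u and v under the derivative of g, is that
    of g. *)
Lemma local_isometry_inv {M N} (S : kahler_data R n M) (T : kahler_data R n N)
    (f : M -> N) (g : N -> M) q :
  charted S -> charted T ->
  local_isometry S T f (g q) -> differentiable_rep T S g q ->
  (\forall q' \near q, f (g q') = q') -> local_isometry T S g q.
Proof.
move=> cS cT [df If] dg fg; split=> // c' c ac' ac dq dgq u v.
have fgq : f (g q) = q := nbhs_singleton fg.
have dfgq : dom c' (f (g q)) by rewrite fgq.
have D w : 'D_('D_w (local_rep g c' c) (fwd c' q)) (local_rep f c c') (fwd c (g q)) = w.
  apply: etrans (esym (derive_rep_comp cT cS w dg df ac' ac ac' dq dgq dfgq)) _.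
  rewrite -[RHS](derive_id (fwd c' q) w); apply: near_eq_derive.
  have nb : nbhs (bwd c' (fwd c' q)) [set q' | f (g q') = q'].
    by rewrite (fwdK (cT.1 _ ac') dq).
  have := bwd_continuous_at (cT.1 _ ac') (fwd_cod dq) nb.
  have := nbhs_cod (cT.1 _ ac') (fwd_cod dq).
  apply: filterS2 => y cy fgy.
  by rewrite /local_rep /= fgy (bwdK (cT.1 _ ac') cy).
apply: etrans _ (esym (If c c' ac ac' dgq dfgq _ _)).
congr (metric _ _ (fwd c' _) _ _); [exact: esym fgq|exact: esym (D u)|exact: esym (D v)].
Qed.

End local_isometries.

(** * Exponential sums *)

Section finite_sums.
Context {R : realType}.

Lemma is_derive_sum_seq (V W : normedModType R) (I : Type) (r : seq I)
    (f : I -> V -> W) (df : I -> W) (x v : V) :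
  (forall i, is_derive x v (f i) (df i)) ->
  is_derive x v (fun y => \sum_(i <- r) f i y) (\sum_(i <- r) df i).
Proof.
move=> dfi; elim: r => [|i r IH].
  rewrite big_nil (_ : (fun _ => _) = cst 0); first exact: is_derive_cst.
  by apply/funext => y; rewrite big_nil.
rewrite big_cons (_ : (fun _ => _) = f i + (fun y => \sum_(j <- r) f j y)).
  exact: is_deriveD.
by apply/funext => y; rewrite big_cons.
Qed.

Lemma differentiable_sum_seq (V W : normedModType R) (I : Type) (r : seq I)
    (f : I -> V -> W) (x : V) :
  (forall i, differentiable (f i) x) ->
  differentiable (fun y => \sum_(i <- r) f i y) x.
Proof.
move=> df; elim: r => [|i r IH].
  rewrite (_ : (fun _ => _) = cst 0); first exact: differentiable_cst.
  by apply/funext => y; rewrite big_nil.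
rewrite (_ : (fun _ => _) = f i + (fun y => \sum_(j <- r) f j y)).
  exact: differentiableD.
by apply/funext => y; rewrite big_cons.
Qed.

Lemma is_derive_expR_affine (a b s : R) :
  is_derive s 1 (fun s => expR (a + s * b)) (b * expR (a + s * b)).
Proof.
have dl : is_derive s 1 (fun s => a + s * b) b.
  by apply: is_derive_eq; rewrite /GRing.scale /=; ring.
by rewrite mulrC; exact: (@is_derive1_comp _ expR _ _ _ _ (is_derive_expR _) dl).
Qed.

Lemma is_derive_expR_mul (b s : R) :
  is_derive s 1 (fun s => expR (s * b)) (b * expR (s * b)).
Proof.
have := is_derive_expR_affine 0 b s; rewrite add0r.
rewrite (_ : (fun s => expR (0 + s * b)) = (fun s => expR (s * b)))//.
by apply/funext => t; rewrite add0r.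
Qed.

Lemma derive0_ball (f : R -> R) (e : R) :
  (forall s : R, `|s| < e -> is_derive s 1 f 0) ->
  forall s, `|s| < e -> f s = f 0.
Proof.
move=> df s se; rewrite -[s]add0r; apply: derive0_cst => t /andP[t0 t1].
have ts : `|0 + t *: s| < e.
  by rewrite add0r (le_lt_trans _ se)// normrM ger0_norm// ler_piMl.
have [dd dE] := df _ ts.
have := @is_derive_dirZ R _ f (0 + t *: s) 1 s dd.
by rewrite dE mulr0 (_ : s *: 1 = s)//; exact: mulr1.
Qed.

End finite_sums.

Section exponential_sums.
Context {R : realType}.

(** The differential operator d/ds - a multiplies the coefficient of exp(s V i) by V i - a and
    preserves vanishing on the interval. *)
Lemma exp_sum_factor (I : finType) (d V : I -> R) (e : R) (l : seq R) :
  (forall s, `|s| < e -> \sum_i d i * expR (s * V i) = 0) ->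
  forall s, `|s| < e ->
    \sum_i d i * (\prod_(a <- l) (V i - a)) * expR (s * V i) = 0.
Proof.
move=> d0; elim: l => [|a l IH] s se.
  by rewrite -[RHS](d0 s se); apply: eq_bigr => i _; rewrite big_nil mulr1.
pose g (s : R) := \sum_i d i * (\prod_(a <- l) (V i - a)) * expR (s * V i).
have dg : is_derive s 1 g
    (\sum_i d i * (\prod_(a <- l) (V i - a)) * (V i * expR (s * V i))).
  apply: is_derive_sum_seq => i.
  have de := is_derive_expR_mul (V i) s.
  by apply: is_derive_eq; rewrite /GRing.scale /= ?mulr0 ?addr0.
have g0 : is_derive s 1 g 0.
  apply: (@near_eq_is_derive _ _ _ (cst 0)).
  have : nbhs s [set t : R | `|t| < e].
    apply: open_nbhs_nbhs; split=> //.
    rewrite (_ : [set t : R | `|t| < e] = ball (0 : R) e); last first.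
      by apply/seteqP; split=> t; rewrite -ball_normE /ball_ /= sub0r normrN.
    by apply: ball_open; rewrite (le_lt_trans _ se).
  by apply: filterS => t te; rewrite /g IH.
have E : \sum_i d i * (\prod_(a <- l) (V i - a)) * (V i * expR (s * V i)) = 0.
  by have [_ <-] := dg; have [_ ->] := g0.
transitivity (\sum_i d i * (\prod_(a <- l) (V i - a)) * (V i * expR (s * V i)) - a * g s).
  rewrite /g mulr_sumr -sumrB; apply: eq_bigr => i _; rewrite big_cons.
  by move: (\prod_(a0 <- l) _) (expR _) => P x; ring.
by rewrite E /g IH// mulr0 subr0.
Qed.

Lemma exp_sum_eq0 (I : finType) (d V : I -> R) (e : R) : 0 < e ->
  (forall s, `|s| < e -> \sum_i d i * expR (s * V i) = 0) ->
  forall v, \sum_(i | V i == v) d i = 0.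
Proof.
move=> e0 d0 v.
(* The factors run over all exponents other than v: every other term is annihilated, and at s = 0
   the terms with exponent v keep a common nonzero factor. *)
pose l := [seq V i | i <- enum I & V i != v].
have := exp_sum_factor l d0 (_ : `|0| < e); rewrite normr0 => /(_ e0).
rewrite (bigID (fun i => V i == v)) /= [X in _ + X]big1 ?addr0; last first.
  move=> i Vi; suff -> : \prod_(a <- l) (V i - a) = 0 by rewrite mulr0 mul0r.
  apply/eqP; rewrite prodf_seq_eq0; apply/hasP; exists (V i); last by rewrite /= subrr.
  by apply: map_f; rewrite mem_filter Vi mem_enum.
rewrite (eq_bigr (fun i => d i * \prod_(a <- l) (v - a))); last first.
  by move=> i /eqP ->; rewrite mul0r expR0 mulr1.
rewrite -mulr_suml => /eqP; rewrite mulf_eq0 prodf_seq_eq0 => /orP[/eqP//|/hasP[a]].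
by move=> /mapP[i]; rewrite mem_filter => /andP[Vi _] ->; rewrite /= subr_eq0 eq_sym (negbTE Vi).
Qed.

Definition tilted_mean (I : finType) (c X : I -> R) (s : R) : R :=
  (\sum_i X i * (c i * expR (s * X i))) / \sum_i c i * expR (s * X i).

(** Both sides are logarithmic derivatives, so the quotient [g] of the two exponential sums is
    constant. Positivity of the coefficients forbids cancellation: an exponent X i missing among the
    X' j would keep a positive total coefficient in a sum that vanishes identically. *)
Lemma tilted_mean_sub (I J : finType) (c X : I -> R) (c' X' : J -> R) (e : R) :
  0 < e -> (0 < #|I|)%N -> (0 < #|J|)%N ->
  (forall i, 0 < c i) -> (forall j, 0 < c' j) ->
  (forall s, `|s| < e -> tilted_mean c X s = tilted_mean c' X' s) ->
  range X `<=` range X'.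
Proof.
move=> e0 I0 J0 c0 c0' mE.
pose Z (K : finType) (b Y : K -> R) (s : R) := \sum_i b i * expR (s * Y i).
have Z_gt0 (K : finType) (b Y : K -> R) s :
    (0 < #|K|)%N -> (forall i, 0 < b i) -> 0 < Z K b Y s.
  move=> /card_gt0P[k _] b0; rewrite /Z (bigD1 k)//= ltr_pwDl//.
    by rewrite mulr_gt0 ?expR_gt0.
  by rewrite sumr_ge0// => i _; rewrite mulr_ge0 ?expR_ge0// ltW.
have dZ (K : finType) (b Y : K -> R) (s : R) :
    is_derive s 1 (Z K b Y) (\sum_i Y i * (b i * expR (s * Y i))).
  apply: is_derive_sum_seq => i.
  have de := is_derive_expR_mul (Y i) s.
  by apply: is_derive_eq; rewrite /GRing.scale /= ?mulr0 ?addr0; ring.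
have zI s := Z_gt0 I c X s I0 c0; have zJ s := Z_gt0 J c' X' s J0 c0'.
pose g s := Z I c X s / Z J c' X' s.
have gE : forall s, `|s| < e -> g s = g 0.
  apply: derive0_ball => s se.
  have nz : Z J c' X' s != 0 by rewrite gt_eqF.
  have dV := @is_deriveV R (Z J c' X') s _ 1 nz (dZ _ c' X' s).
  have dI := dZ _ c X s.
  apply: is_derive_eq; rewrite /GRing.scale /=.
  have := mE s se; rewrite /tilted_mean -/(Z I c X s) -/(Z J c' X' s).
  move/(canRL (divfK (lt0r_neq0 (zI s)))) => ->.
  by field.
(* The relation Z - g(0) Z' = 0 is written as a single exponential sum over the disjoint union of
   the index sets. *)
pose d (k : I + J) := match k with inl i => c i | inr j => - (g 0 * c' j) end.
pose V (k : I + J) := match k with inl i => X i | inr j => X' j end.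
have dV0 s : `|s| < e -> \sum_k d k * expR (s * V k) = 0.
  move=> se; rewrite big_sumType /= -/(Z I c X s).
  rewrite (eq_bigr (fun j => - g 0 * (c' j * expR (s * X' j)))); last first.
    by move=> j _; rewrite mulNr mulNr mulrA.
  rewrite -mulr_sumr -/(Z J c' X' s) -(gE s se) /g mulNr divfK ?subrr//.
  by rewrite gt_eqF.
move=> v [i _ <-]; apply: contrapT => nv.
have := exp_sum_eq0 e0 dV0 (X i).
rewrite big_sumType /= [X in _ + X]big1 ?addr0; last first.
  by move=> j /eqP E; case: nv; exists j.
rewrite (bigD1 i)//= => /eqP; rewrite paddr_eq0 ?(ltW (c0 i))//.
  by rewrite gt_eqF.
by rewrite sumr_ge0// => k _; rewrite ltW.
Qed.

End exponential_sums.

(** * The Fisher metric and gradients of means *)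

Lemma line_is_derive {R : realType} (V W : normedModType R) (f : V -> W) (x v : V) d :
  is_derive (0 : R) 1 (fun h : R => f (x + h *: v)) d -> is_derive x v f d.
Proof.
have E : (fun h : R => h^-1 *: (((fun h : R => f (x + h *: v)) \o shift 0) (h *: 1)
    - f (x + 0 *: v))) =
  (fun h : R => h^-1 *: ((f \o shift x) (h *: v) - f x)).
  apply/funext => h /=; rewrite scale0r addr0 addr0 (_ : h *: 1 = h); last exact: mulr1.
  by rewrite [x + _]addrC.
move=> [dd dE]; apply: DeriveDef; first by rewrite /derivable -E.
by rewrite -dE /derive -E.
Qed.

Section fisher.
Context {R : realType} {n : nat} {Omega : finType} (E : exp_family R n Omega).
Implicit Types (theta v w : 'rV[R]_n) (X : Omega -> R).

Definition statistic v x : R := \sum_k v ord0 k * efF E k x.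

Lemma statistic_linear x : linear (statistic ^~ x).
Proof.
move=> c v w; rewrite /statistic scaler_sumr -big_split /=.
by apply: eq_bigr => k _; rewrite !mxE mulrDl -mulrA.
Qed.

Definition weight theta x : R := expR (efC E x + statistic theta x).

Definition partition_fun theta : R := \sum_x weight theta x.

Lemma statistic_line theta v x (h : R) :
  statistic (theta + h *: v) x = statistic theta x + h * statistic v x.
Proof. by rewrite addrC statistic_linear addrC. Qed.

Lemma weight_line theta v x (h : R) :
  weight (theta + h *: v) x = expR (efC E x + statistic theta x + h * statistic v x).
Proof. by rewrite /weight statistic_line addrA. Qed.

Lemma weight_gt0 theta x : 0 < weight theta x.
Proof. exact: expR_gt0. Qed.

Lemma efp_psi theta : partition_fun theta * expR (- efpsi E theta) = 1.
Proof.
rewrite -[RHS](ef_prob E theta) /partition_fun mulr_suml.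
by apply: eq_bigr => x _; rewrite /exp_density [RHS]expRD.
Qed.

Lemma partition_gt0 theta : 0 < partition_fun theta.
Proof. by have := ltr01 (R := R); rewrite -(efp_psi theta) pmulr_lgt0// expR_gt0. Qed.

Lemma Omega_gt0 : (0 < #|Omega|)%N.
Proof.
rewrite lt0n; apply/eqP => /card0_eq O0.
have := partition_gt0 0; rewrite /partition_fun big1 ?ltxx// => x _.
by have := O0 x; rewrite inE.
Qed.

Lemma efpE theta x : efp E theta x = weight theta x / partition_fun theta.
Proof.
rewrite /efp /exp_density expRD -/(weight theta x); congr (_ * _).
have z0 := lt0r_neq0 (partition_gt0 theta).
by apply: (mulfI z0); rewrite efp_psi divff.
Qed.

Lemma efp_gt0 theta x : 0 < efp E theta x.
Proof. exact: expR_gt0. Qed.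

Lemma expect_efpE theta X :
  expect (efp E theta) X = (\sum_x X x * weight theta x) / partition_fun theta.
Proof.
by rewrite /expect mulr_suml; apply: eq_bigr => x _; rewrite efpE mulrA.
Qed.

Lemma efpsiE theta : efpsi E theta = ln (partition_fun theta).
Proof.
have z0 := lt0r_neq0 (partition_gt0 theta).
have -> : partition_fun theta = expR (efpsi E theta).
  have := efp_psi theta; rewrite expRN => /(canRL (divfK _)).
  by rewrite mul1r; apply; rewrite gt_eqF// expR_gt0.
by rewrite expRK.
Qed.

Lemma is_derive_weighted X theta v :
  is_derive theta v (fun t => \sum_x X x * weight t x)
    (\sum_x X x * (statistic v x * weight theta x)).
Proof.
apply: is_derive_sum_seq => x; apply: line_is_derive.
rewrite (_ : (fun h => _) = (fun h : R => X x *
   expR (efC E x + statistic theta x + h * statistic v x))); last first.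
  by apply/funext => h; rewrite weight_line.
have de := @is_derive_expR_affine R (efC E x + statistic theta x) (statistic v x) 0.
rewrite mul0r addr0 -/(weight theta x) in de.
by apply: is_derive_eq; rewrite /GRing.scale /= ?mulr0 ?addr0.
Qed.

Lemma is_derive_partition theta v :
  is_derive theta v partition_fun (\sum_x statistic v x * weight theta x).
Proof.
have := is_derive_weighted (cst 1) theta v.
rewrite (_ : (fun t => _) = partition_fun); last first.
  by apply/funext => t; apply: eq_bigr => x _; rewrite mul1r.
by under eq_bigr do rewrite mul1r.
Qed.

(** The score: the derivative of ln p_theta(x) in the direction v. The Fisher metric is its
    covariance. *)
Definition centered theta x v : R :=
  statistic v x - expect (efp E theta) (statistic v).

Lemma centered_linear theta x : linear (centered theta x).
Proof.
move=> c v w; rewrite /centered statistic_linear /expect.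
under eq_bigr do rewrite statistic_linear mulrDl.
rewrite big_split /= scalerBr addrACA -opprD; congr (_ - (_ + _)).
by rewrite scaler_sumr; apply: eq_bigr => y _; rewrite -mulrA.
Qed.

HB.instance Definition _ theta x :=
  GRing.isLinear.Build R 'rV[R]_n R _ (centered theta x) (centered_linear theta x).

Lemma derive_ln_efp theta v x :
  'D_v (fun t => ln (efp E t x)) theta = centered theta x v.
Proof.
have z0 := partition_gt0 theta.
have dln : is_derive theta v (fun t => ln (partition_fun t))
    ((\sum_x statistic v x * weight theta x) / partition_fun theta).
  apply: line_is_derive.
  have [dp dpE] := is_derive_partition theta v.
  have := @is_derive_line R _ _ partition_fun theta v 0.
  rewrite scale0r addr0 => /(_ dp); rewrite dpE => dl.
  have z0' : 0 < partition_fun (theta + 0 *: v) by exact: partition_gt0.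
  have := @is_derive1_comp R (@ln R) (fun h => partition_fun (theta + h *: v)) 0 _ _
    (is_derive1_ln z0') dl.
  by rewrite scale0r addr0 mulrC.
have dst : is_derive theta v (fun t => efC E x + statistic t x) (statistic v x).
  apply: line_is_derive; under eq_fun do rewrite statistic_line.
  by apply: is_derive_eq; rewrite /GRing.scale /=; ring.
rewrite (_ : (fun t => _) = (fun t => efC E x + statistic t x)
   - (fun t => ln (partition_fun t))); last first.
  by apply/funext => t; rewrite /efp /exp_density expRK efpsiE.
rewrite (@derive_val _ _ _ _ _ _ _ (is_deriveB dst dln)).
by rewrite /centered expect_efpE.
Qed.

Lemma fisher_form theta v w : (v *m fisher E theta *m w^T) ord0 ord0 =
  \sum_x efp E theta x * (centered theta x v * centered theta x w).
Proof.
have cen z x : centered theta x z = \sum_i z ord0 i * centered theta x (unitv i).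
  rewrite {1}(row_sum_delta z) linear_sum /=.
  by apply: eq_bigr => i _; rewrite linearZ.
rewrite mxE; under eq_bigr => j _ do rewrite !mxE mulr_suml.
under eq_bigr => j _ do under eq_bigr => i _ do
  rewrite /fisher mxE /expect mulr_sumr mulr_suml.
under eq_bigr => j _ do rewrite exchange_big /=.
rewrite exchange_big /=; apply: eq_bigr => x _.
rewrite (cen v) (cen w) mulrCA mulr_suml.
rewrite exchange_big /=; apply: eq_bigr => i _.
rewrite mulr_sumr mulr_sumr; apply: eq_bigr => j _.
rewrite !derive_ln_efp; ring.
Qed.

Lemma TE_metricE (u v w : TE) : TE_metric E u v w =
  \sum_x efp E u.1 x * (centered u.1 x v.1 * centered u.1 x w.1
                      + centered u.1 x v.2 * centered u.1 x w.2).
Proof.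
rewrite /TE_metric !fisher_form -big_split /=.
by apply: eq_bigr => x _; rewrite [RHS]mulrDr.
Qed.

Lemma TE_metricB_sqr (u v w : TE) : TE_metric E u (v - w) (v - w) =
  TE_metric E u v v - 2 * TE_metric E u v w + TE_metric E u w w.
Proof.
rewrite !TE_metricE mulr_sumr -sumrB -big_split /=; apply: eq_bigr => x _.
have -> : centered u.1 x (v - w).1 = centered u.1 x v.1 - centered u.1 x w.1.
  exact: linearB.
have -> : centered u.1 x (v - w).2 = centered u.1 x v.2 - centered u.1 x w.2.
  exact: linearB.
move: (efp E u.1 x) (centered _ _ v.1) (centered _ _ w.1) (centered _ _ v.2)
  (centered _ _ w.2) => p a b c d; ring.
Qed.

Lemma TE_metric_ge0 (u v : TE) : 0 <= TE_metric E u v v.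
Proof.
rewrite TE_metricE sumr_ge0// => x _; rewrite mulr_ge0 ?(ltW (efp_gt0 _ _))//.
by rewrite -!expr2 addr_ge0// sqr_ge0.
Qed.

(** A direction of zero variance has a constant statistic, as all probabilities are positive, and
    the linear independence of 1, F_1, ..., F_n makes the direction zero. *)
Lemma TE_metric_definite (u v : TE) : TE_metric E u v v <= 0 -> v = 0.
Proof.
move=> v0; have {v0} : TE_metric E u v v = 0.
  by apply/eqP; rewrite eq_le v0 TE_metric_ge0.
rewrite TE_metricE => /eqP; rewrite psumr_eq0; last first.
  move=> x _; rewrite mulr_ge0 ?(ltW (efp_gt0 _ _))//.
  by rewrite -!expr2 addr_ge0// sqr_ge0.
move=> /allP cv0.
have cen0 x : centered u.1 x v.1 = 0 /\ centered u.1 x v.2 = 0.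
  have := cv0 x; rewrite mem_index_enum => /(_ isT) /=.
  rewrite mulf_eq0 (gt_eqF (efp_gt0 _ _)) /= -!expr2.
  by rewrite paddr_eq0 ?sqr_ge0// !sqrf_eq0 => /andP[/eqP-> /eqP->].
have free z : (forall x, centered u.1 x z = 0) -> z = 0.
  move=> z0; have [x|_ zk] := @ef_free _ _ _ E
      (- expect (efp E u.1) (statistic z)) (fun k => z ord0 k).
    by rewrite addrC; exact: z0.
  by apply/rowP => k; rewrite mxE zk.
have v1 : v.1 = 0 by apply: free => x; case: (cen0 x).
have v2 : v.2 = 0 by apply: free => x; case: (cen0 x).
by move: v1 v2; case: v {cv0 cen0} => v1 v2 /= -> ->.
Qed.

Lemma differentiable_weighted X theta :
  differentiable (fun t => \sum_x X x * weight t x) theta.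
Proof.
apply: differentiable_sum_seq => x.
have dst : differentiable (fun t => statistic t x) theta.
  apply: differentiable_sum_seq => k.
  by apply: differentiableM => //; exact: differentiable_coord.
apply: differentiableM => //.
apply: (@differentiable_comp _ _ _ _ (fun t => efC E x + statistic t x) expR).
  exact: differentiableD.
by apply/derivable1_diffP; exact: derivable_expR.
Qed.

Lemma differentiable_partition theta : differentiable partition_fun theta.
Proof.
have := differentiable_weighted (cst 1) theta.
rewrite (_ : (fun t => _) = partition_fun)//.
by apply/funext => t; apply: eq_bigr => x _; rewrite mul1r.
Qed.

Definition mean_fun X (u : TE) : R := expect (efp E u.1) X.

Lemma mean_funE X : mean_fun X =
  (fun t => (\sum_x X x * weight t x) * (partition_fun t)^-1) \o fst.
Proof. by apply/funext => u; rewrite /mean_fun expect_efpE. Qed.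

Lemma differentiable_fst (u : TE) : differentiable (fst : TE -> 'rV[R]_n) u.
Proof. exact: linear_differentiable (fun z => cvg_fst). Qed.

Lemma differentiable_mean_fun X (u : TE) : differentiable (mean_fun X) u.
Proof.
rewrite mean_funE; apply: differentiable_comp; first exact: differentiable_fst.
apply: differentiableM; first exact: differentiable_weighted.
by apply: differentiableV; [exact: differentiable_partition|rewrite gt_eqF// partition_gt0].
Qed.

Lemma derive_mean_fun X (a0 : R) (a : 'rV[R]_n) (u v : TE) :
  (forall x, X x = a0 + statistic a x) ->
  'D_v (mean_fun X) u = TE_metric E u (a, 0) v.
Proof.
move=> XE.
have z0 := lt0r_neq0 (partition_gt0 u.1).
have dw := is_derive_weighted X u.1 v.1.
have dz := is_derive_partition u.1 v.1.
have -> : 'D_v (mean_fun X) u =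
    expect (efp E u.1) (fun x => X x * statistic v.1 x)
    - expect (efp E u.1) X * expect (efp E u.1) (statistic v.1).
  have -> : 'D_v (mean_fun X) u =
      'D_(v.1) (fun t => (\sum_x X x * weight t x) * (partition_fun t)^-1) u.1.
    rewrite mean_funE derive_chain; [|exact: differentiable_fst|]; last first.
      apply: differentiableM; first exact: differentiable_weighted.
      by apply: differentiableV; [exact: differentiable_partition|].
    congr ('D_ _ _ _); rewrite deriveE; last exact: differentiable_fst.
    by rewrite diff_lin//; exact: (fun z => cvg_fst).
  have [dw1 dw2] := dw; have [dz1 dz2] := dz.
  rewrite deriveM//; last exact: derivableV.
  rewrite deriveV// dw2 dz2 !expect_efpE /GRing.scale /=.
  have -> : \sum_x X x * (statistic v.1 x * weight u.1 x) =
      \sum_x X x * statistic v.1 x * weight u.1 x.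
    by apply: eq_bigr => x _; rewrite mulrA.
  by field.
rewrite TE_metricE /= /expect; set p := efp E u.1.
have p1 : \sum_x p x = 1 by exact: ef_prob.
set mv := \sum_x statistic v.1 x * p x.
set ma := \sum_x statistic a x * p x.
have c0 x : centered u.1 x 0 = 0 by rewrite linear0.
have cE z x : centered u.1 x z = statistic z x - \sum_x statistic z x * p x by [].
transitivity (\sum_x (X x * statistic v.1 x * p x - X x * p x * mv)).
  by rewrite sumrB -mulr_suml.
(* A multiple of the zero sum of p (statistic v.1 - mv) is subtracted in order to center X as well;
   the identity then holds term by term. *)
transitivity (\sum_x (X x * statistic v.1 x * p x - X x * p x * mv)
  - (a0 + ma) * (\sum_x (statistic v.1 x * p x - mv * p x))).
  have -> : \sum_x (statistic v.1 x * p x - mv * p x) = 0.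
    by rewrite sumrB -/mv -mulr_sumr p1 mulr1 subrr.
  by rewrite mulr0 subr0.
rewrite mulr_sumr -sumrB; apply: eq_bigr => x _.
by rewrite c0 mul0r addr0 !cE -/mv -/ma XE; ring.
Qed.

End fisher.

(** * The transition map *)

Section transition.
Context {R : realType} {n : nat} {Omega : finType} (E : exp_family R n Omega).
Context {N : topologicalType} (S : kahler_data R n N) (Phi : torus R n -> N -> N).
Hypothesis toricN : kahler_toric S Phi.

Lemma EL_charted (Y : 'I_n -> 'rV[R]_n -> 'rV[R]_n) :
  parallel_frame Y -> charted (EL_kahler E Y).
Proof.
move=> YP; split=> [c [] //|z].
have [c [cP cY cu _]] := qL_section YP (EL_repr z).
exists c; first by split.
by have := bwd_dom cP cu; rewrite cY /qL /EL_repr reprK.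
Qed.

Lemma Aut_inverse_isometry (phi : N -> N) : Aut S phi ->
  exists psi : N -> N, [/\ cancel phi psi, cancel psi phi,
    forall p, local_isometry S S phi p & forall p, local_isometry S S psi p].
Proof.
move=> [[sphi rphi [psi [phiK spsi]]] _ Iphi].
have cS := kahler_charted (kt_kahler toricN).
have psiK : cancel psi phi.
  move=> q; have [p _ <-] : range phi q by rewrite rphi.
  by rewrite phiK.
have Lphi p : local_isometry S S phi p.
  exact: (isometric_local_isometry cS cS openT sphi Iphi).
exists psi; split=> // p; apply: (local_isometry_inv cS cS (Lphi _)).
  exact: (smooth_differentiable_rep cS cS openT spsi).
by apply: nearW => q; exact: psiK.
Qed.

Lemma parametrization_inverse_isometry (Y : 'I_n -> 'rV[R]_n -> 'rV[R]_n)
    (G : EL Y -> N) : toric_parametrization E S Phi G ->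
  exists g : N -> EL Y, [/\ cancel G g,
    forall q, free_points Phi q -> G (g q) = q,
    forall z, local_isometry (EL_kahler E Y) S G z &
    forall q, free_points Phi q -> local_isometry S (EL_kahler E Y) g q].
Proof.
move=> [YP [sG rG [g [GK sg]]] _ IG _].
have cS := kahler_charted (kt_kahler toricN); have cE := EL_charted YP.
have fo := free_points_open toricN.
have gK q : free_points Phi q -> G (g q) = q.
  by rewrite -rG => -[z _ <-]; rewrite GK.
have LG z : local_isometry (EL_kahler E Y) S G z.
  exact: (isometric_local_isometry cE cS openT sG IG).
exists g; split=> // q fq; apply: (local_isometry_inv cE cS (LG _)).
  exact: (smooth_differentiable_rep cS cE fo sg).
by apply: filterS gK _; exact: open_nbhs_nbhs.
Qed.

Section two_parametrizations.
Variables (Y Y' : 'I_n -> 'rV[R]_n -> 'rV[R]_n) (G : EL Y -> N) (G' : EL Y' -> N).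
Hypotheses (GP : toric_parametrization E S Phi G)
           (GP' : toric_parametrization E S Phi G').
Variables (phi phi' : N -> N).
Hypotheses (phiP : Aut S phi) (phiP' : Aut S phi').

(* The transition map G'^-1 o phi' o phi^-1 o G, read in the coordinates of TE *)
Lemma transition_isometry (u0 u0' : TE) (p0 : N) :
  G (qL Y u0) = phi p0 -> G' (qL Y' u0') = phi' p0 ->
  exists H : TE -> TE, exists2 e : R, 0 < e & H u0 = u0' /\ forall u, ball u0 e u ->
   [/\ differentiable H u,
       forall v w, TE_metric E u v w = TE_metric E (H u) ('D_v H u) ('D_w H u) &
       exists p, G (qL Y u) = phi p /\ G' (qL Y' (H u)) = phi' p].
Proof.
move=> Gu0 Gu0'.
have YP : parallel_frame Y by case: GP.
have YP' : parallel_frame Y' by case: GP'.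
have cS := kahler_charted (kt_kahler toricN).
have cE := EL_charted YP; have cE' := EL_charted YP'.
have fo := free_points_open toricN.
have [psi [phiK psiK Lphi Lpsi]] := Aut_inverse_isometry phiP.
have [psi' [_ _ Lphi' _]] := Aut_inverse_isometry phiP'.
have [g [GK gK LG Lg]] := parametrization_inverse_isometry GP.
have [g' [GK' gK' LG' Lg']] := parametrization_inverse_isometry GP'.
pose F1 := phi' \o (psi \o G).
have LF1 z : local_isometry (EL_kahler E Y) S F1 z.
  apply: (local_isometry_comp cE cS); last exact: Lphi'.
  exact: (local_isometry_comp cE cS).
(* On this open set [g'] is applied only at free points, where it inverts [G']. *)
pose A := F1 @^-1` free_points Phi.
have oA : open A.
  by apply: open_comp => // z _; have [[+ _] _] := LF1 z.
pose F := g' \o F1.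
have LF z : A z -> local_isometry (EL_kahler E Y) (EL_kahler E Y') F z.
  by move=> Az; apply: (local_isometry_comp cE cS) => //; exact: Lg'.
have [c [cP cY cu0 cK]] := qL_section YP u0.
have [c' [cP' cY' cu0' cK']] := qL_section YP' u0'.
have ac : atlas (EL_kahler E Y) c by split.
have ac' : atlas (EL_kahler E Y') c' by split.
have F1u0 : F1 (qL Y u0) = phi' p0 by rewrite /F1 /= Gu0 phiK.
have Au0 : A (qL Y u0).
  by rewrite /A /= F1u0 -Gu0'; have [_ [_ <- _] _ _ _] := GP'; exists (qL Y' u0').
have Fu0 : F (qL Y u0) = qL Y' u0' by rewrite /F /= F1u0 -Gu0' GK'.
have oU : open (local_dom A F c c').
  by apply: local_dom_open => // z /set_mem/LF[[]].
have Uu0 : local_dom A F c c' u0.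
  apply/local_domP => //; rewrite cY; split=> //.
  by rewrite Fu0 -cY'; exact: bwd_dom.
have /nbhs_ballP[e /= e0 eU] : nbhs u0 (local_dom A F c c') by exact: open_nbhs_nbhs.
(* In charts that are local sections of q_L, the local representative is already a map between the
   coordinates of the two tangent bundles. *)
exists (local_rep F c c'), e => //; split.
  by rewrite /local_rep cY Fu0; exact: cK'.
move=> u /eU/(local_domP _ _ _ _ cP)[cu]; rewrite cY => Au dFu.
have dqu : dom c (qL Y u) by rewrite -cY; exact: bwd_dom.
have [[_ dF] IF] := LF _ Au.
have Eu : fwd c (qL Y u) = u by exact: cK.
split.
- by have := dF _ _ ac ac' dqu dFu; rewrite Eu.
- move=> v w; have := IF _ _ ac ac' dqu dFu v w; rewrite Eu /=.
  by rewrite /local_rep cY.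
- exists (psi (G (qL Y u))); split; first by rewrite psiK.
  rewrite /local_rep cY -{1}cY' (fwdK cP' dFu) /F /=.
  by rewrite gK'.
Qed.

Variables (X X' : Omega -> R) (a0 a0' : R) (a a' : 'rV[R]_n) (f : N -> R).
Hypotheses (XE : forall x, X x = a0 + statistic E a x)
           (XE' : forall x, X' x = a0' + statistic E a' x).
Hypotheses (fE : forall u p, G (qL Y u) = phi p -> f p = mean_fun E X u)
           (fE' : forall u p, G' (qL Y' u) = phi' p -> f p = mean_fun E X' u).

Let al : TE := (a, 0).
Let al' : TE := (a', 0).

(** H carries one mean to the other, so the product of al' with DH al at H u is the derivative of
    the first mean along its own gradient, |al|^2. As H is isometric, |DH al|^2 = |al|^2 too, and
    the expansion of |al' - DH al|^2 leaves |al'|^2 - |al|^2. *)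
Lemma transition_gradient (u0 u0' : TE) (p0 : N) :
  G (qL Y u0) = phi p0 -> G' (qL Y' u0') = phi' p0 ->
  exists H : TE -> TE, exists2 e : R, 0 < e & H u0 = u0' /\ forall u, ball u0 e u ->
   [/\ differentiable H u,
       mean_fun E X u = mean_fun E X' (H u),
       TE_metric E (H u) (al' - 'D_al H u) (al' - 'D_al H u) =
         TE_metric E (H u) al' al' - TE_metric E u al al &
       exists p, G (qL Y u) = phi p /\ G' (qL Y' (H u)) = phi' p].
Proof.
move=> Gu0 Gu0'; have [H [e e0 [Hu0 HP]]] := transition_isometry Gu0 Gu0'.
exists H, e => //; split=> // u ue; have [dH IH [p [Gp Gp']]] := HP u ue.
have mE v : ball u0 e v -> mean_fun E X v = mean_fun E X' (H v).
  by move=> /HP[_ _ [q [/fE <- /fE' <-]]].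
split=> //; [exact: mE| |by exists p].
have D : TE_metric E u al al = TE_metric E (H u) al' ('D_al H u).
  apply: etrans (esym (derive_mean_fun u al XE)) _.
  apply: etrans _ (derive_mean_fun (H u) ('D_al H u) XE').
  apply: etrans _ (derive_chain al dH (differentiable_mean_fun E X' (H u))).
  apply: near_eq_derive; have : nbhs u (ball u0 e).
    by apply: open_nbhs_nbhs; split=> //; exact: ball_open.
  by apply: filterS => v /mE.
by rewrite TE_metricB_sqr -D -IH; move: (TE_metric E u al al) => x; ring.
Qed.

(** The difference of the two sides is a squared norm. The inequality with the two parametrizations
    exchanged then forces al' = DH al, without inverting DH. *)
Lemma gradient_norm_le (u u' : TE) (p : N) :
  G (qL Y u) = phi p -> G' (qL Y' u') = phi' p ->
  TE_metric E u al al <= TE_metric E u' al' al'.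
Proof.
move=> Gu Gu'; have [H [e e0 [Hu HP]]] := transition_gradient Gu Gu'.
have [_ _ D _] := HP u (ballxx _ e0); rewrite Hu in D.
by rewrite -subr_ge0 -D TE_metric_ge0.
Qed.

End two_parametrizations.
End transition.

(** Along the gradient line the weights are multiplied by exp(s X(x)) exp(-s a0), and the second
    factor, independent of x, cancels in the quotient. *)
Lemma mean_fun_tilted {R : realType} {n : nat} {Omega : finType}
    (E : exp_family R n Omega) (X : Omega -> R) (a0 : R) (a : 'rV[R]_n) (u : TE) (s : R) :
  (forall x, X x = a0 + statistic E a x) ->
  mean_fun E X (u + s *: ((a, 0) : TE)) = tilted_mean (weight E u.1) X s.
Proof.
move=> XE; rewrite /mean_fun /= expect_efpE /tilted_mean /partition_fun.
have wE x : weight E (u.1 + s *: a) x =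
    weight E u.1 x * expR (s * X x) * expR (- (s * a0)).
  rewrite weight_line /weight -!expRD XE; congr expR; ring.
under eq_bigr => x _ do rewrite wE mulrA.
under [X in _ / X]eq_bigr => x _ do rewrite wE.
rewrite -!mulr_suml -mulf_div divff ?mulr1//.
by rewrite gt_eqF// expR_gt0.
Qed.

(** * Gradient lines and comparison of the images of X and X' *)

Section flow.
Context {R : realType} {n : nat} {Omega : finType} (E : exp_family R n Omega).
Context {N : topologicalType} (S : kahler_data R n N) (Phi : torus R n -> N -> N).
Hypothesis toricN : kahler_toric S Phi.
Variables (Y Y' : 'I_n -> 'rV[R]_n -> 'rV[R]_n) (G : EL Y -> N) (G' : EL Y' -> N).
Hypotheses (GP : toric_parametrization E S Phi G)
           (GP' : toric_parametrization E S Phi G').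
Variables (phi phi' : N -> N).
Hypotheses (phiP : Aut S phi) (phiP' : Aut S phi').
Variables (X X' : Omega -> R) (a0 a0' : R) (a a' : 'rV[R]_n) (f : N -> R).
Hypotheses (XE : forall x, X x = a0 + statistic E a x)
           (XE' : forall x, X' x = a0' + statistic E a' x).
Hypotheses (fE : forall u p, G (qL Y u) = phi p -> f p = mean_fun E X u)
           (fE' : forall u p, G' (qL Y' u) = phi' p -> f p = mean_fun E X' u).

Let al : TE := (a, 0).
Let al' : TE := (a', 0).

Lemma mean_fun_flow (u0 u0' : TE) (p0 : N) :
  G (qL Y u0) = phi p0 -> G' (qL Y' u0') = phi' p0 ->
  exists2 e : R, 0 < e & forall s, `|s| < e ->
    mean_fun E X (u0 + s *: al) = mean_fun E X' (u0' + s *: al').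
Proof.
move=> Gu0 Gu0'.
have [H [e e0 [Hu0 HP]]] :=
  transition_gradient toricN GP GP' phiP phiP' XE XE' fE fE' Gu0 Gu0'.
have DH u : ball u0 e u -> 'D_al H u = al'.
  move=> /HP[_ _ D [p [Gp Gp']]]; apply/esym/eqP; rewrite -subr_eq0; apply/eqP.
  apply: (@TE_metric_definite _ _ _ E (H u)); rewrite D subr_le0.
  exact: (gradient_norm_le toricN GP' GP phiP' phiP XE' XE fE' fE Gp' Gp).
have al1 : 0 < `|al| + 1 by rewrite ltr_wpDl.
(* The summand 1 covers al = 0, which occurs when X is constant. *)
exists (e / (`|al| + 1)); first by rewrite divr_gt0.
have inb (s : R) : `|s| < e / (`|al| + 1) -> ball u0 e (u0 + s *: al).
  rewrite ltr_pdivlMr// => se; rewrite -ball_normE /ball_ /=.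
  rewrite opprD addrA subrr sub0r normrN normrZ (le_lt_trans _ se)//.
  by rewrite ler_wpM2l// lerDl.
move=> s se; have [_ -> _ _] := HP _ (inb s se); congr (mean_fun E X' _).
apply: Cspace_ext => b i.
(* Each coordinate of H(u0 + t al) - t al' has zero derivative, so H maps the gradient line through
   u0 to the one through u0' with the same parameter. *)
pose q (t : R) := crd b i (H (u0 + t *: al)) - t * crd b i al'.
have dq (t : R) : `|t| < e / (`|al| + 1) -> is_derive t 1 q 0.
  move=> /inb tb; have [dH _ _ _] := HP _ tb.
  have := is_derive_linear (@crd_continuous R n b i) (diff_derivable (v := al) dH).
  rewrite (DH _ tb) => -[d1 d2].
  have := is_derive_line d1; rewrite d2 => dl.
  have dt : is_derive t 1 (fun t : R => t * crd b i al') (crd b i al').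
    by apply: is_derive_eq; rewrite /GRing.scale /=; ring.
  by have := is_deriveB dl dt; rewrite subrr.
have := derive0_ball dq se; rewrite /q scale0r addr0 mul0r subr0 Hu0.
move=> /(canRL (subrK _)) ->.
by rewrite linearD linearZ.
Qed.

Lemma range_sub (u0 u0' : TE) (p0 : N) :
  G (qL Y u0) = phi p0 -> G' (qL Y' u0') = phi' p0 -> range X `<=` range X'.
Proof.
move=> Gu0 Gu0'; have [e e0 He] := mean_fun_flow Gu0 Gu0'.
apply: (tilted_mean_sub (c := weight E u0.1) (c' := weight E u0'.1) e0).
- exact: Omega_gt0 E.
- exact: Omega_gt0 E.
- exact: weight_gt0.
- exact: weight_gt0.
- by move=> s /He; rewrite (mean_fun_tilted _ _ XE) (mean_fun_tilted _ _ XE').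
Qed.

End flow.

Theorem corollary6p22 (R : realType) (n : nat) (Omega : finType)
    (E : exp_family R n Omega)
    (N : topologicalType) (S : kahler_data R n N) (Phi : torus R n -> N -> N)
    (toricN : kahler_toric S Phi)
    (torifN : regular_torification E S Phi)
    (injF : injective (estimator E))
    (f : N -> R) (kahlerf : kahler_function S f)
    (phi phi' : N -> N) (autphi : Aut0 S phi) (autphi' : Aut0 S phi')
    (X X' : Omega -> R) (AX : A_space E X) (AX' : A_space E X')
    (K K' : N -> Omega -> R)
    (extK : exists2 kappa, compatible_projection E S Phi kappa &
                           natural_extension E Phi kappa K)
    (extK' : exists2 kappa', compatible_projection E S Phi kappa' &
                             natural_extension E Phi kappa' K')
    (fK : forall p : N, f p = expect (K (phi p)) X)
    (fK' : forall p : N, f p = expect (K' (phi' p)) X') :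
  range X = range X'.
Proof.
have phiP : Aut S phi := connected_component_sub autphi.
have phiP' : Aut S phi' := connected_component_sub autphi'.
have [kappa [Y [G [GP kG]]] [_ _ Kk]] := extK.
have [kappa' [Y' [G' [GP' kG']]] [_ _ Kk']] := extK'.
have A_row Z : A_space E Z ->
    exists (b0 : R) (b : 'rV[R]_n), forall x, Z x = b0 + statistic E b x.
  move=> [b0 [b ZE]]; exists b0, (\row_k b k) => x; rewrite ZE; congr (_ + _).
  by apply: eq_bigr => k _; rewrite mxE.
have [a0 [a XE]] := A_row _ AX; have [a0' [a' XE']] := A_row _ AX'.
have rG : range G = free_points Phi by case: GP => _ [].
have rG' : range G' = free_points Phi by case: GP' => _ [].
have fE u p : G (qL Y u) = phi p -> f p = mean_fun E X u.
  move=> Gp; rewrite fK -Gp Kk; last by rewrite -rG; exists (qL Y u).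
  by rewrite kG piLE.
have fE' u p : G' (qL Y' u) = phi' p -> f p = mean_fun E X' u.
  move=> Gp; rewrite fK' -Gp Kk'; last by rewrite -rG'; exists (qL Y' u).
  by rewrite kG' piLE.
have [psi [phiK psiK _ Lpsi]] := Aut_inverse_isometry toricN phiP.
have [psi' [phiK' psiK' _ Lpsi']] := Aut_inverse_isometry toricN phiP'.
have [p [fp fp']] : exists p, free_points Phi (phi p) /\ free_points Phi (phi' p).
  have fo := free_points_open toricN.
  (* In terms of q = phi' p, freeness of phi p is the open condition that phi (psi' q) be free; it
     remains to meet it with the dense set of free q. *)
  pose O := (phi \o psi') @^-1` free_points Phi.
  have Lphi q : local_isometry S S phi q.
    by have [? [_ _ + _]] := Aut_inverse_isometry toricN phiP; apply.
  have oO : open O.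
    apply: open_comp => // q _; apply: continuous_comp.
      by have [[+ _] _] := Lpsi' q.
    by have [[+ _] _] := Lphi (psi' q).
  have O0 : O !=set0.
    (* The q for which phi p is the free point G (qL Y 0). *)
    exists (phi' (psi (G (qL Y 0)))); rewrite /O /= phiK' psiK -rG.
    by exists (qL Y 0).
  have [q [Oq fq]] := free_points_dense toricN O0 oO.
  by exists (psi' q); split=> //; rewrite psiK'.
have qLr (Z : 'I_n -> 'rV[R]_n -> 'rV[R]_n) (z : EL Z) : exists u, z = qL Z u.
  by exists (EL_repr z); rewrite /qL /EL_repr reprK.
have [z Gz] : exists z, G z = phi p by move: fp; rewrite -rG => -[z _ <-]; exists z.
have [z' Gz'] : exists z, G' z = phi' p by move: fp'; rewrite -rG' => -[z' _ <-]; exists z'.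
have [u zu] := qLr _ z; have [u' zu'] := qLr _ z'; subst z z'.
apply/seteqP; split.
  exact: (range_sub toricN GP GP' phiP phiP' XE XE' fE fE' Gz Gz').
exact: (range_sub toricN GP' GP phiP' phiP XE' XE fE' fE Gz' Gz).
Qed.
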